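(* Let $[q^{\mathrm C},y^{\mathrm C},w^{\mathrm C},\pi^{\mathrm C},\rho^{\mathrm C}]$ be the solution of $[\text{COST-LCP}]$, and let $[\text{FLOW-LP}]$ be the linear program in $[q,y]$ built from $[w^{\mathrm C},\pi^{\mathrm C},\rho^{\mathrm C}]$, with objective $Z^{\mathrm F}$. The generalized queue replacement principle (GQRP) holds if and only if $[\text{FLOW-LP}]$ is feasible and its optimal value is zero, i.e. $Z^{\mathrm F}(q^{\mathrm F},y^{\mathrm F})=0$, where $[q^{\mathrm F},y^{\mathrm F}]$ denotes the solution of $[\text{FLOW-LP}]$.
   Context: **Network.** A directed network has a finite set $\mathcal N$ of $N$ origin nodes, one destination node $d$, and a finite set $\mathcal L$ of $L$ directed links. Link $(i,j)\in\mathcal L$ has bottleneck capacity $\mu_{ij}>0$ and free-flow travel time $c_{ij}\ge 0$. Origin $i$ has demand $Q_i\ge 0$. $\mathcal T$ is the time interval of destination arrival times $t$. The schedule delay cost $s:\mathcal T\to\mathbb R$ is convex, $s(t^{\mathrm P})=0$ for the common preferred arrival time $t^{\mathrm P}$, and $\dot s(t)>-1$ with $\dot s(t)$ finite for all $t$. Vectors $\mu,c\in\mathbb R^L$ and $Q\in\mathbb R^N$ collect these data; the vector $s(t)\in\mathbb R^N$ has all components equal to the scalar $s(t)$; $M=\mathrm{diag}(\mu)$. $A\in\mathbb R^{N\times L}$ is the node-link incidence matrix without the destination row: the entry in row $k$, column $(i,j)$ is $1$ if $k=i$, $-1$ if $k=j$, and $0$ otherwise. $A_+$ is $A$ with negative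 entries replaced by $0$, so $(A_+^\top x)_{ij}=x_i$. By convention $\pi_d(t)=0$. An overdot is $d/dt$. $0\le a\perp b\ge 0$ means $a,b\ge 0$ componentwise and $a^\top b=0$. Products of vectors inside integrals are inner products. Functions of $t$ are assumed regular enough for the integrals and derivatives written to make sense; conditions involving derivatives are imposed where the derivatives exist. **Variables** (indexed by destination arrival time $t$): $q(t)\in\mathbb R^N$ (destination arrival flow by origin), $y(t)\in\mathbb R^L$ (destination arrival flow of users passing each link), $w(t)\in\mathbb R^L$ (queueing delay on each link), $\pi(t)\in\mathbb R^N$ (earliest travel time from each node to the destination), $\rho\in\mathbb R^N$ (equilibrium travel cost of each origin). **$[\text{DUE-LCP}]$**: find $[q,y,w,\pi,\rho]\ge 0$ such that $\int_{\mathcal T} q(t)\,dt=Q$ and, for all $t\in\mathcal T$, - $Ay(t)-q(t)=0$; - $0\le M\dot w(t)-MA_+^\top\dot\pi(t)+\mu-y(t)\perp w(t)\ge 0$; - $\dot\pi(t)\le 1$ (componentwise); - $0\le w(t)-A^\top\pi(t)+c\perp y(t)\ge 0$; - $0\le \pi(t)+s(t)-\rho\perp q(t)\ge 0$. A solution is written $[q^{\mathrm{UE}},y^{\mathrm{UE}},w^{\mathrm{UE}},\pi^{\mathrm{UE}},\rho^{\mathrm{UE}}]$. **$[\text{COST-LCP}]$**: find $[q,y,w,\pi,\rho]\ge 0$ such that $\int_{\mathcal T} q(t)\,dt=Q$ and, for all $t\in\mathcal T$, $Ay(t)-q(t)=0$; $0\le\mu-y(t)\perp w(t)\ge 0$;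 $0\le w(t)-A^\top\pi(t)+c\perp y(t)\ge 0$; $0\le\pi(t)+s(t)-\rho\perp q(t)\ge 0$. Its solution carries the superscript $\mathrm C$. **Convention.** Where $\pi_i(t)$ is not determined by the equilibrium conditions, it is specified as the earliest travel time implied by the queueing delay pattern $w$. **GQRP.** The GQRP holds if the queueing delay pattern $w^{\mathrm{UE}}$ of $[\text{DUE-LCP}]$ equals that of $[\text{COST-LCP}]$: $w^{\mathrm{UE}}(t)=w^{\mathrm C}(t)$ for all $t\in\mathcal T$; that is, $[\text{DUE-LCP}]$ has a solution whose queueing-delay component is $w^{\mathrm C}$. **$[\text{FLOW-LP}]$**: with $\overline\theta(t)=\dot w^{\mathrm C}(t)-A_+^\top\dot\pi^{\mathrm C}(t)+1$ (here $1$ is the all-ones vector), minimize over $[q,y]\ge 0$ $$Z^{\mathrm F}(q,y)=Z^{\mathrm P}(q,y)+Z^{\mathrm Q}(w^{\mathrm C},\pi^{\mathrm C})-Z^{\mathrm D}(w^{\mathrm C},\pi^{\mathrm C},\rho^{\mathrm C})$$ subject to $\int_{\mathcal T} q(t)\,dt=Q$ and, for all $t\in\mathcal T$, $Ay(t)-q(t)=0$ and $M\overline\theta(t)-y(t)\ge 0$, where $Z^{\mathrm P}(q,y)=\int_{\mathcal T}s(t)q(t)\,dt+\int_{\mathcal T}c\,y(t)\,dt$, $Z^{\mathrm Q}(w,\pi)=\int_{\mathcal T}w(t)\,(M\dot w(t))\,dt-\int_{\mathcal T}w(t)\,(MA_+^\top\dot\pi(t))\,dt$, $Z^{\mathrm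 D}(w,\pi,\rho)=-\int_{\mathcal T}\mu\,w(t)\,dt+Q^\top\rho$. *)

(* Defs.v *)
From mathcomp Require Import all_boot all_order all_algebra.
From mathcomp Require Import all_classical all_reals all_analysis.

Set Implicit Arguments.
Unset Strict Implicit.
Unset Printing Implicit Defensive.

Import Order.TTheory GRing.Theory Num.Theory.
Import numFieldNormedType.Exports.

Local Open Scope classical_set_scope.
Local Open Scope ring_scope.

(* Origins are the elements of 'I_N; as a node of the network, origin i is     *)
(* [Some i] and the destination d is [None].  The set of links is enumerated,  *)
(* without repetition, by 'I_L.                                                *)
Record network (R : realType) (N L : nat) := Network {
  link : 'I_L -> option 'I_N * option 'I_N ;
  capacity : 'cV[R]_L ;
  free_time : 'cV[R]_L ;
  demand : 'cV[R]_N ;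
  link_inj : injective link ;
  link_neq : forall e, (link e).1 != (link e).2 ;
  capacity_gt0 : forall e, 0 < capacity e 0 ;
  free_time_ge0 : forall e, 0 <= free_time e 0 ;
  demand_ge0 : forall i, 0 <= demand i 0 }.

Section Vectors.
Variable R : realType.

Definition nonneg n (a : 'cV[R]_n) : Prop := forall i, 0 <= a i 0.

Definition dot n (a b : 'cV[R]_n) : R := (a^T *m b) 0 0.

Definition perp n (a b : 'cV[R]_n) : Prop :=
  [/\ nonneg a, nonneg b & dot a b = 0].

Definition vintegral n (T : set R) (f : R -> 'cV[R]_n) : 'cV[R]_n :=
  \col_i (\int[lebesgue_measure]_(t in T) f t i 0).

End Vectors.

Section Regularity.
Variable R : realType.
Implicit Types (T : set R) (f : R -> R).

(* [lebesgue_measure] lives on the Borel sets; a function is integrable in the *)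
(* sense of Lebesgue (for the completed sigma-algebra) when it agrees almost   *)
(* everywhere with a Borel integrable function.                                *)
Definition lebesgue_integrable T f : Prop :=
  exists2 g : R -> R, lebesgue_measure.-integrable T (EFin \o g) &
    {ae lebesgue_measure, forall t, T t -> f t = g t}.

(* Local absolute continuity on T: f is differentiable almost everywhere and   *)
(* is recovered by integrating its derivative.                                 *)
Definition absolutely_continuous T f : Prop :=
  {ae lebesgue_measure, forall t : R, T° t -> derivable f t 1} /\
  forall u v, T u -> T v -> u <= v ->
    lebesgue_integrable `[u, v] (derive1 f) /\
    f v - f u = \int[lebesgue_measure]_(t in `[u, v]) derive1 f t.

End Regularity.

Section Model.
Variables (R : realType) (N L : nat) (G : network R N L).
Variables (T : interval R) (s : R -> R).

Local Notation mu := (capacity G).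
Local Notation c := (free_time G).
Local Notation Q := (demand G).
Local Notation TT := [set` T].

(* A derivative of s is only required to satisfy the bound where it exists, so *)
(* that s may have kinks.                                                      *)
Definition schedule_cost (tP : R) : Prop :=
  [/\ tP \in T, s tP = 0, convex_function TT (s : R^o -> R^o) &
      forall t : R, TT° t -> derivable s t 1 -> -1 < derive1 s t].

Definition incidence : 'M[R]_(N, L) :=
  \matrix_(k, e) (((link G e).1 == Some k)%:R - ((link G e).2 == Some k)%:R).

Definition incidence_pos : 'M[R]_(N, L) := map_mx (Num.max 0) incidence.

Definition capacity_mx : 'M[R]_L := diag_mx mu^T.

Local Notation A := incidence.
Local Notation Ap := incidence_pos.
Local Notation M := capacity_mx.

Definition sched (t : R) : 'cV[R]_N := const_mx (s t).

Fixpoint route (x : option 'I_N) (p : seq 'I_L) : bool :=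
  if p is e :: p' then ((link G e).1 == x) && route (link G e).2 p'
  else x == None.

Definition route_time (w : 'cV[R]_L) (p : seq 'I_L) : R :=
  \sum_(e <- p) (c e 0 + w e 0).

(* The complementarity conditions may leave the travel times p undetermined at *)
(* nodes that carry no flow, so p is pinned everywhere to the shortest route   *)
(* time for the delays w.  In particular every origin is required to have a    *)
(* route to the destination.                                                   *)
Definition earliest_travel_time (w : R -> 'cV[R]_L) (p : R -> 'cV[R]_N) : Prop :=
  forall t, t \in T -> forall i,
    (exists2 r, route (Some i) r & p t i 0 = route_time (w t) r) /\
    (forall r, route (Some i) r -> p t i 0 <= route_time (w t) r).

Definition regular_flow (q : R -> 'cV[R]_N) (y : R -> 'cV[R]_L) : Prop :=
  [/\ forall i, lebesgue_integrable TT (fun t => q t i 0),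
      forall i, lebesgue_integrable TT (fun t => s t * q t i 0) &
      forall e, lebesgue_integrable TT (fun t => y t e 0)].

Definition regular_delay (w : R -> 'cV[R]_L) (p : R -> 'cV[R]_N) : Prop :=
  [/\ forall e, absolutely_continuous TT (fun t => w t e 0),
      forall i, absolutely_continuous TT (fun t => p t i 0),
      forall e, lebesgue_integrable TT (fun t => w t e 0),
      forall e, lebesgue_integrable TT (fun t => w t e 0 * derive1 w t e 0) &
      forall e,
        lebesgue_integrable TT (fun t => w t e 0 * (Ap^T *m derive1 p t) e 0)].

Definition nonneg_vars (q : R -> 'cV[R]_N) (y w : R -> 'cV[R]_L)
    (p : R -> 'cV[R]_N) (rho : 'cV[R]_N) : Prop :=
  (forall t, t \in T ->
     [/\ nonneg (q t), nonneg (y t), nonneg (w t) & nonneg (p t)]) /\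
  nonneg rho.

Definition cost_lcp (q : R -> 'cV[R]_N) (y w : R -> 'cV[R]_L)
    (p : R -> 'cV[R]_N) (rho : 'cV[R]_N) : Prop :=
  [/\ nonneg_vars q y w p rho,
      vintegral TT q = Q &
      forall t, t \in T ->
        [/\ A *m y t - q t = 0,
            perp (mu - y t) (w t),
            perp (w t - A^T *m p t + c) (y t) &
            perp (p t + sched t - rho) (q t)]].

(* The conditions on derivatives bear on the points of the interior of T where *)
(* the vector derivatives they mention exist.                                  *)
Definition due_lcp (q : R -> 'cV[R]_N) (y w : R -> 'cV[R]_L)
    (p : R -> 'cV[R]_N) (rho : 'cV[R]_N) : Prop :=
  [/\ nonneg_vars q y w p rho,
      vintegral TT q = Q,
      forall t : R, TT° t -> derivable w t 1 -> derivable p t 1 ->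
        perp (M *m derive1 w t - M *m Ap^T *m derive1 p t + mu - y t) (w t),
      forall t : R, TT° t -> derivable p t 1 -> forall i, derive1 p t i 0 <= 1 &
      forall t, t \in T ->
        [/\ A *m y t - q t = 0,
            perp (w t - A^T *m p t + c) (y t) &
            perp (p t + sched t - rho) (q t)]].

Definition cost_solution q y w p rho : Prop :=
  [/\ cost_lcp q y w p rho, earliest_travel_time w p,
      regular_flow q y & regular_delay w p].

Definition due_solution q y w p rho : Prop :=
  [/\ due_lcp q y w p rho, earliest_travel_time w p,
      regular_flow q y & regular_delay w p].

Definition gqrp (wC : R -> 'cV[R]_L) : Prop :=
  exists q y w p rho,
    due_solution q y w p rho /\ forall t, t \in T -> w t = wC t.

Section FlowLP.
Variables (wC : R -> 'cV[R]_L) (pC : R -> 'cV[R]_N) (rhoC : 'cV[R]_N).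

Definition theta_bar (t : R) : 'cV[R]_L :=
  derive1 wC t - Ap^T *m derive1 pC t + const_mx 1.

Definition flow_lp_feasible (q : R -> 'cV[R]_N) (y : R -> 'cV[R]_L) : Prop :=
  [/\ regular_flow q y,
      forall t, t \in T -> nonneg (q t) /\ nonneg (y t),
      vintegral TT q = Q,
      forall t, t \in T -> A *m y t - q t = 0 &
      forall t : R, TT° t -> derivable wC t 1 -> derivable pC t 1 ->
        nonneg (M *m theta_bar t - y t)].

Definition ZP (q : R -> 'cV[R]_N) (y : R -> 'cV[R]_L) : R :=
  \int[lebesgue_measure]_(t in TT) dot (sched t) (q t) +
  \int[lebesgue_measure]_(t in TT) dot c (y t).

Definition ZQ (w : R -> 'cV[R]_L) (p : R -> 'cV[R]_N) : R :=
  \int[lebesgue_measure]_(t in TT) dot (w t) (M *m derive1 w t) -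
  \int[lebesgue_measure]_(t in TT) dot (w t) (M *m Ap^T *m derive1 p t).

Definition ZD (w : R -> 'cV[R]_L) (rho : 'cV[R]_N) : R :=
  - (\int[lebesgue_measure]_(t in TT) dot mu (w t)) + dot Q rho.

Definition ZF (q : R -> 'cV[R]_N) (y : R -> 'cV[R]_L) : R :=
  ZP q y + ZQ wC pC - ZD wC rhoC.

Definition flow_lp_solution (q : R -> 'cV[R]_N) (y : R -> 'cV[R]_L) : Prop :=
  flow_lp_feasible q y /\
  forall q' y', flow_lp_feasible q' y' -> ZF q y <= ZF q' y'.

End FlowLP.

End Model.

(* Main.v *)
Require Import Defs.
From mathcomp Require Import all_boot all_order all_algebra.
From mathcomp Require Import all_classical all_reals all_analysis.
From mathcomp Require Import measurable_realfun ring lra.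

Set Implicit Arguments.
Unset Strict Implicit.
Unset Printing Implicit Defensive.

Import Order.TTheory GRing.Theory Num.Theory.
Import numFieldNormedType.Exports.
Local Open Scope classical_set_scope.
Local Open Scope ring_scope.

(** The flow program and the equilibrium are tied together by duality. For a
    feasible flow, conservation of flow turns the integrand of the objective
    [ZF] into the sum of the three complementarity products of the dynamic user
    equilibrium: link cost against link flow, delay against spare outflow, and
    origin cost against origin flow (gap_densityE). Each product is nonnegative
    almost everywhere, so the optimal value is nonnegative (weak_duality), and
    the objective is zero at a flow exactly when that flow is complementary to
    the delays and travel times of the cost solution almost everywhere.

    If the principle holds, the equilibrium has the delays of the cost solution,
    hence also its travel times, which are determined as shortest route times.
    Its flow is then feasible with zero gap; the two vectors of equilibrium costs
    may differ, but not at an origin with positive demand (gqrp_flow_lp_solution).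

    Conversely, a flow with zero gap is an equilibrium flow up to a null set, and
    two points remain. First, the equilibrium conditions are required at every
    time where the derivatives exist. At such a time the flow is replaced by a
    limit of its averages over shrinking intervals to the right, which inherits
    all the conditions (exists_admissible_flow). Secondly, travel times must have
    slope at most 1, which is not a constraint of the cost problem. It follows
    from the network structure, the nonnegativity of the outflow, and the bound
    -1 on the slope of the schedule cost (derive_travel_time_le1_at); the latter
    is usable because a convex function is differentiable at some point of every
    interval (convex_derivable_point). *)

(** * Integrals of functions equal almost everywhere to integrable ones *)

Section NonmeasurableIntegral.
Context d (X : measurableType d) (R : realType).
Variable mu : {measure set X -> \bar R}.
Local Open Scope ereal_scope.

Lemma ge0_le_lower_integral (D : set X) (f g : X -> \bar R) :
  (forall x, D x -> 0 <= f x) -> (forall x, D x -> f x <= g x) ->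
  \int[mu]_(x in D) f x <= \int[mu]_(x in D) g x.
Proof.
move=> f0 fg; rewrite !ge0_integralE//; last first.
  by move=> x Dx; exact: le_trans (f0 _ Dx) (fg _ Dx).
apply: ereal_sup_le => _ [h /= hf <-]; exists h => //= x.
apply: le_trans (hf x) _; rewrite !patchE; case: ifPn => // /set_mem; exact: fg.
Qed.

(** The integral of a function that need not be measurable is a supremum over
    the simple functions below it, hence monotone; and [f] lies between [g] set
    to 0 and [g] set to infinity on the null set where the two differ, which are
    measurable with the integral of [g]. *)
Lemma ae_eq_ge0_integral (D : set X) (f g : X -> \bar R) :
  measurable D -> measurable_fun D g ->
  (forall x, D x -> 0 <= f x) -> (forall x, D x -> 0 <= g x) ->
  {ae mu, forall x, D x -> f x = g x} ->
  \int[mu]_(x in D) f x = \int[mu]_(x in D) g x.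
Proof.
move=> mD mg f0 g0 [N [mN N0 subN]].
have fgN x : D x -> ~ N x -> f x = g x.
  by move=> Dx Nx; apply: contrapT => fgx; apply/Nx/subN => /= /(_ Dx).
have mNC : measurable (~` N) by exact: measurableC.
pose l := g \_ (~` N).
pose u x := (g \_ (~` N)) x + (cst +oo \_ N) x.
have uE x : u x = if x \in N then +oo else g x.
  by rewrite /u !patchE in_setC; case: (x \in N); rewrite /= ?add0e ?adde0.
have lE x : l x = if x \in N then 0 else g x.
  by rewrite /l patchE in_setC; case: (x \in N).
have mP (h : X -> \bar R) (E : set X) : measurable E -> measurable_fun D h ->
    measurable_fun D (h \_ E).
  by move=> mE mh; apply/measurable_restrict => //; exact: measurable_funS mh.
have ml : measurable_fun D l by exact: mP.
have mu' : measurable_fun D u.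
  by apply: emeasurable_funD; [exact: mP|apply: mP => //; exact: measurable_cst].
have lD x : D x -> 0 <= l x by move=> Dx; rewrite lE; case: ifP => // _; exact: g0.
have uD x : D x -> 0 <= u x.
  by move=> Dx; rewrite uE; case: ifP => // _; exact: g0.
have ae_N (h : X -> \bar R) : (forall x, ~ N x -> h x = g x) ->
    ae_eq mu D h g.
  move=> hN; exists N; split => // x /= hx; apply: contrapT => Nx.
  by apply: hx => _; exact: hN.
have El : \int[mu]_(x in D) l x = \int[mu]_(x in D) g x.
  apply: ge0_ae_eq_integral => //; apply: ae_N => x Nx.
  by rewrite lE memNset.
have Eu : \int[mu]_(x in D) u x = \int[mu]_(x in D) g x.
  apply: ge0_ae_eq_integral => //; apply: ae_N => x Nx.
  by rewrite uE memNset.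
apply/eqP; rewrite eq_le; apply/andP; split.
  rewrite -Eu; apply: ge0_le_lower_integral => // x Dx.
  rewrite uE; case: ifPn => [_|]; first exact: leey.
  by rewrite notin_setE => Nx; rewrite fgN.
rewrite -El; apply: ge0_le_lower_integral => // x Dx.
rewrite lE; case: ifPn => [_|]; first exact: f0.
by rewrite notin_setE => Nx; rewrite fgN.
Qed.

Lemma ae_eq_integral_nonmeasurable (D : set X) (f g : X -> \bar R) :
  measurable D -> measurable_fun D g ->
  {ae mu, forall x, D x -> f x = g x} ->
  \int[mu]_(x in D) f x = \int[mu]_(x in D) g x.
Proof.
move=> mD mg /ae_eq_funeposneg[fgp fgn].
rewrite integralE [in RHS]integralE; congr (_ - _).
- by apply: ae_eq_ge0_integral => //; exact: measurable_funepos.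
- by apply: ae_eq_ge0_integral => //; exact: measurable_funeneg.
Qed.

Lemma ae_eq0_Rintegral (D : set X) (g : X -> R) :
  measurable D -> mu.-integrable D (EFin \o g) ->
  {ae mu, forall x, D x -> (0 <= g x)%R} -> Rintegral mu D g = 0%R ->
  {ae mu, forall x, D x -> (EFin \o g) x = 0}.
Proof.
move=> mD gi g0 g0i; have mg := measurable_int _ gi.
apply/(ae_eq_integral_abs mu mD mg).
have E : ae_eq mu D (abse \o (EFin \o g)) (EFin \o g).
  by apply: filterS g0 => t g0 Dt; rewrite /= ger0_norm// g0.
rewrite (@ae_eq_integral _ _ _ mu D _ (abse \o (EFin \o g)) mD _ mg E);
  last exact: measurableT_comp.
move: g0i; rewrite /Rintegral => /eqP.
by rewrite fine_eq0 ?integrable_fin_num// => /eqP.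
Qed.

End NonmeasurableIntegral.

#[local] Instance ae_lebesgue_filter (R : realType) :
  Filter (nbhs (almost_everywhere (@lebesgue_measure R))).
Proof. exact: ae_filter_ringOfSetsType. Qed.

Section LebesgueIntegrable.
Variable R : realType.
Local Notation mu := (@lebesgue_measure R).
Implicit Types (D E : set R) (f g : R -> R).

(** Integrability and the value travel together through linear combinations,
    so that an integral of a sum is never split before its terms are known to
    be integrable. *)
Definition has_integral D f v :=
  lebesgue_integrable D f /\ \int[mu]_(t in D) f t = v.

Lemma has_integralP D f v : measurable D ->
  has_integral D f v <-> exists g, [/\ mu.-integrable D (EFin \o g),
    {ae mu, forall t, D t -> f t = g t} & \int[mu]_(t in D) g t = v].
Proof.
move=> mD.
have E g : mu.-integrable D (EFin \o g) ->
    {ae mu, forall t, D t -> f t = g t} ->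
    \int[mu]_(t in D) f t = \int[mu]_(t in D) g t.
  move=> gi fg.
  have fg' : {ae mu, forall t, D t -> (EFin \o f) t = (EFin \o g) t}.
    by apply: filterS fg => t fg Dt; rewrite /= fg.
  congr fine.
  apply: (@ae_eq_integral_nonmeasurable _ _ _ mu D (EFin \o f) _ mD _ fg').
  exact: measurable_int gi.
split=> [[[g gi fg] <-]|[g [gi fg <-]]]; first by exists g; rewrite -(E g).
by split; [exists g|exact: E].
Qed.

Lemma has_integral_ae D f g v : measurable D ->
  {ae mu, forall t, D t -> f t = g t} ->
  has_integral D g v -> has_integral D f v.
Proof.
move=> mD fg /(has_integralP _ _ mD)[h [hi gh hv]].
apply/(has_integralP _ _ mD); exists h; split => //.
by apply: filterS2 fg gh => t fg gh Dt; rewrite fg// gh.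
Qed.

Lemma eq_has_integral D f g v : measurable D ->
  (forall t, D t -> f t = g t) -> has_integral D g v -> has_integral D f v.
Proof. by move=> mD fg; apply: has_integral_ae => //; exact: aeW. Qed.

Lemma lebesgue_integrable_ae D f g : measurable D ->
  {ae mu, forall t, D t -> f t = g t} ->
  lebesgue_integrable D g -> lebesgue_integrable D f.
Proof. by move=> mD fg gi; have [] := has_integral_ae mD fg (conj gi erefl). Qed.

Lemma eq_lebesgue_integrable D f g : measurable D ->
  (forall t, D t -> f t = g t) ->
  lebesgue_integrable D g -> lebesgue_integrable D f.
Proof. by move=> mD fg; apply: lebesgue_integrable_ae => //; exact: aeW. Qed.

Lemma has_integral0 D : measurable D -> has_integral D (fun=> 0) 0.
Proof.
move=> mD; apply/(has_integralP _ _ mD); exists (fun=> 0); split.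
- exact: (@integrable0 _ _ _ mu).
- exact: aeW.
- by rewrite /Rintegral integral0.
Qed.

Lemma has_integralD D f g u v : measurable D ->
  has_integral D f u -> has_integral D g v ->
  has_integral D (fun t => f t + g t) (u + v).
Proof.
move=> mD /(has_integralP _ _ mD)[f' [fi ff' <-]].
move=> /(has_integralP _ _ mD)[g' [gi gg' <-]].
apply/(has_integralP _ _ mD); exists (fun t => f' t + g' t); split.
- exact: (@integrableD _ _ _ mu D mD _ _ fi gi).
- by apply: filterS2 ff' gg' => t fE gE Dt; rewrite fE// gE.
- exact: RintegralD.
Qed.

Lemma has_integralZ D f (k u : R) : measurable D ->
  has_integral D f u -> has_integral D (fun t => k * f t) (k * u).
Proof.
move=> mD /(has_integralP _ _ mD)[f' [fi ff' <-]].
apply/(has_integralP _ _ mD); exists (fun t => k * f' t); split.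
- exact: (@integrableZl _ _ _ mu D mD k _ fi).
- by apply: filterS ff' => t fE Dt; rewrite fE.
- exact: RintegralZl.
Qed.

Lemma lebesgue_integrableZ D f (k : R) : measurable D ->
  lebesgue_integrable D f -> lebesgue_integrable D (fun t => k * f t).
Proof. by move=> mD fi; have [] := has_integralZ k mD (conj fi erefl). Qed.

Lemma has_integralB D f g u v : measurable D ->
  has_integral D f u -> has_integral D g v ->
  has_integral D (fun t => f t - g t) (u - v).
Proof.
move=> mD fi /(has_integralZ (-1) mD) gi.
rewrite -mulN1r; apply: (eq_has_integral mD _ (has_integralD mD fi gi)).
by move=> t _; rewrite mulN1r.
Qed.

Lemma has_integral_sum D n (f : 'I_n -> R -> R) u : measurable D ->
  (forall i, has_integral D (f i) (u i)) ->
  has_integral D (fun t => \sum_i f i t) (\sum_i u i).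
Proof.
move=> mD; elim: n f u => [|n IH] f u fi.
  rewrite big_ord0; apply: (eq_has_integral mD _ (has_integral0 mD)) => t _.
  by rewrite big_ord0.
rewrite big_ord_recr /=.
apply: (eq_has_integral mD (g := fun t =>
  \sum_(i < n) f (widen_ord (leqnSn n) i) t + f ord_max t)).
  by move=> t _; rewrite big_ord_recr.
by apply: has_integralD => //; exact: IH.
Qed.

Lemma lebesgue_integrable_subset D E f : measurable D -> measurable E -> E `<=` D ->
  lebesgue_integrable D f -> lebesgue_integrable E f.
Proof.
move=> mD mE ED [g gi fg]; exists g;
  first exact: (@integrableS _ _ _ mu _ _ _ mD mE ED gi).
by apply: filterS fg => t fg /ED.
Qed.

Lemma has_integral_ge0 D f v : measurable D ->
  {ae mu, forall t, D t -> 0 <= f t} -> has_integral D f v -> 0 <= v.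
Proof.
move=> mD f0 fi.
suff [_ <-] : has_integral D (fun t => Num.max 0 (f t)) v.
  by apply: Rintegral_ge0 => t _; rewrite le_max lexx.
apply: (has_integral_ae mD _ fi); apply: filterS f0 => t f0 Dt.
by apply/max_idPr; exact: f0.
Qed.

Lemma has_integral_le D f g u v : measurable D ->
  {ae mu, forall t, D t -> f t <= g t} ->
  has_integral D f u -> has_integral D g v -> u <= v.
Proof.
move=> mD fg fi gi; rewrite -subr_ge0.
apply: (has_integral_ge0 mD _ (has_integralB mD gi fi)).
by apply: filterS fg => t fg Dt; rewrite subr_ge0 fg.
Qed.

Lemma has_integral_eq0 D f : measurable D ->
  {ae mu, forall t, D t -> 0 <= f t} -> has_integral D f 0 ->
  {ae mu, forall t, D t -> f t = 0}.
Proof.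
move=> mD f0 /(has_integralP _ _ mD)[g [gi fg g0]].
have g0' : {ae mu, forall t, D t -> 0 <= g t}.
  by apply: filterS2 fg f0 => t fg f0 Dt; rewrite -fg// f0.
have gz0 := @ae_eq0_Rintegral _ _ _ mu D g mD gi g0' g0.
apply: filterS2 fg gz0 => t fg gz Dt; rewrite fg//.
by have /= [] := gz Dt.
Qed.

Lemma has_integral_cst (a b k : R) : a <= b ->
  has_integral `[a, b] (fun=> k) (k * (b - a)).
Proof.
move=> ab; have mD : measurable `[a, b] by exact: measurable_itv.
apply/(has_integralP _ _ mD); exists (fun=> k); split.
- apply/integrableP; split; first exact: measurable_cst.
  rewrite integral_cst//= lebesgue_measure_itv/= lte_fin.
  case: ifPn => _; last by rewrite mule0 ltry.
  exact: ltry.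
- exact: aeW.
- rewrite Rintegral_cst//= lebesgue_measure_itv/= lte_fin.
  case: ifPn => //=; rewrite -leNgt => ba.
  suff -> : b = a by rewrite subrr mulr0.
  by apply/eqP; rewrite eq_le ab ba.
Qed.

End LebesgueIntegrable.

(** * Difference quotients and intervals *)

Section DifferenceQuotient.
Variable R : realType.
Implicit Types (f : R -> R) (t k : R).

Lemma cvg_quotient f t : derivable f t 1 ->
  h^-1 * (f (t + h) - f t) @[h --> 0^'] --> derive1 f t.
Proof.
move=> df; rewrite derive1E.
have E : (fun h => h^-1 *: (f (h *: 1 + t) - f t)) =
         (fun h => h^-1 * (f (t + h) - f t)).
  by apply/funext => h; rewrite [h *: 1]mulr1 (addrC h).
by move: df; rewrite /derivable /derive E => /cvg_ex[l dl]; rewrite (cvg_lim _ dl).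
Qed.

Lemma derive1_le_right f t k (e : R) : derivable f t 1 -> 0 < e ->
  (forall h, 0 < h <= e -> f (t + h) - f t <= k * h) -> derive1 f t <= k.
Proof.
move=> /cvg_quotient/cvg_dnbhs_at_right df e0 fk.
apply: (cvgr_to_le df); near=> h.
have h0 : 0 < h by near: h; exact: nbhs_right_gt.
rewrite ler_pdivrMl// mulrC fk// h0.
by near: h; exact: nbhs_right_le.
Unshelve. all: by end_near. Qed.

Lemma derive1_le_left f t k (e : R) : derivable f t 1 -> 0 < e ->
  (forall h, 0 < h <= e -> f t - f (t - h) <= k * h) -> derive1 f t <= k.
Proof.
move=> df e0 fk; have := cvg_quotient df => /cvg_dnbhs_at_left.
move=> /cvg_at_leftNP; rewrite oppr0 => dfl.
apply: (cvgr_to_le dfl); near=> h.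
have h0 : 0 < h by near: h; exact: nbhs_right_gt.
rewrite /= invrN mulNr -mulrN opprB ler_pdivrMl// mulrC fk// h0.
by near: h; exact: nbhs_right_le.
Unshelve. all: by end_near. Qed.

Lemma derive1_local_max f t (e : R) : derivable f t 1 -> 0 < e ->
  (forall u, `|u - t| <= e -> f u <= f t) -> derive1 f t = 0.
Proof.
move=> df e0 fmax; apply/eqP; rewrite eq_le; apply/andP; split.
  apply: (derive1_le_right df e0) => h /andP[h0 he].
  rewrite mul0r subr_le0 fmax// addrAC subrr add0r.
  by rewrite gtr0_norm.
have dnf : derivable (- f) t 1 by exact: derivableN.
have E : derive1 (- f) t = - derive1 f t by rewrite !derive1E deriveN.
rewrite -oppr_le0 -E.
apply: (derive1_le_left dnf e0) => h /andP[h0 he].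
rewrite mul0r /= opprK addrC subr_le0 fmax//.
by rewrite addrAC subrr add0r normrN gtr0_norm.
Qed.

End DifferenceQuotient.

Section Interval.
Variable R : realType.
Variable T : interval R.
Local Notation TT := [set` T].

Lemma interior_itvP t : TT° t -> exists2 e : R, 0 < e &
  forall u, `|u - t| <= e -> TT u.
Proof.
rewrite /interior /= => /nbhs_ballP[e /= e0 eT].
exists (e / 2); first by rewrite divr_gt0.
move=> u ue; apply: eT; rewrite /ball/= distrC (le_lt_trans ue)//.
by rewrite ltr_pdivrMr// ltr_pMr// ltr1n.
Qed.

Lemma itv_between a b t : TT a -> TT b -> a <= t <= b -> TT t.
Proof. by move=> Ta Tb /andP[at_ tb]; apply: (interval_is_interval Ta Tb); rewrite at_. Qed.

Lemma itv_betweenoo a b t : TT a -> TT b -> a < t < b -> TT° t.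
Proof.
move=> Ta Tb atb.
have oab : open `]a, b[%classic by exact: interval_open.
have : `]a, b[%classic `<=` TT.
  move=> x /=; rewrite in_itv/= => /andP[ax xb].
  by apply: (itv_between Ta Tb); rewrite !ltW.
by rewrite open_subsetE// => /(_ t); apply; rewrite /= in_itv.
Qed.

(** A point of an interval outside its interior is its least or its greatest
    element, so at most two points are lost. *)
Lemma ae_interior_itv :
  {ae @lebesgue_measure R, forall t, TT t -> TT° t}.
Proof.
suff cN : countable [set t | TT t /\ ~ TT° t].
  exists [set t | TT t /\ ~ TT° t]; split.
  - exact: countable_measurable.
  - exact: countable_lebesgue_measure0.
  - by move=> t /= /not_implyP.
pose m := [set t | TT t /\ forall u, TT u -> t <= u].
pose M := [set t | TT t /\ forall u, TT u -> u <= t].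
have fm : finite_set m.
  have [->|/set0P[x [Tx xm]]] := eqVneq m set0; first exact: finite_set0.
  apply: (sub_finite_set _ (finite_set1 x)) => y [Ty ym] /=; apply/eqP.
  by rewrite eq_le ym//= xm.
have fM : finite_set M.
  have [->|/set0P[x [Tx xM]]] := eqVneq M set0; first exact: finite_set0.
  apply: (sub_finite_set _ (finite_set1 x)) => y [Ty yM] /=; apply/eqP.
  by rewrite eq_le yM// xM.
apply: finite_set_countable; apply: (@sub_finite_set _ _ (m `|` M)).
  2: by rewrite finite_setU.
move=> t [Tt Tt'].
have [ma|/existsNP[u /not_implyP[Tu /negP]]] := pselect (forall u, TT u -> t <= u).
  by left.
rewrite -ltNge => ut.
have [Ma|/existsNP[v /not_implyP[Tv /negP]]] := pselect (forall u, TT u -> u <= t).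
  by right.
rewrite -ltNge => tv; exfalso; apply: Tt'.
by apply: (itv_betweenoo Tu Tv); rewrite ut.
Qed.

End Interval.

(** * Differentiability of convex functions *)

Section Convex.
Variable R : realType.
Implicit Types (s : R -> R) (a b u v x y z : R).

Lemma convex_three_points (D : set R) s x y z :
  convex_function D (s : R^o -> R^o) -> D x -> D z -> x < y < z ->
  (s y - s x) * (z - y) <= (s z - s y) * (y - x).
Proof.
move=> cs Dx Dz /andP[xy yz].
have zx : 0 < z - x by rewrite subr_gt0 (lt_trans xy).
pose k := (z - y) / (z - x).
have k0 : 0 <= k by rewrite divr_ge0 ?ltW// subr_gt0.
have k1 : k <= 1 by rewrite ler_pdivrMr// mul1r lerD2l lerN2 ltW.
have kE : k * (z - x) = z - y by rewrite /k divfK// gt_eqF.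
have := cs (Itv01 k0 k1) x z; rewrite !inE => /(_ Dx Dz).
have -> : conv (Itv01 k0 k1) (x : convex_lmodType R^o) z = y.
  rewrite [LHS](_ : _ = k * x + (1 - k) * z :> R)//.
  by move: kE; lra.
rewrite convRE /= /unstable.onem /=.
move=> H.
have {}H : (z - x) * s y <= (z - y) * s x + (y - x) * s z.
  have -> : (z - y) * s x + (y - x) * s z =
     (z - x) * (k * s x + (1 - k) * s z).
    have -> : y - x = (1 - k) * (z - x) by move: kE; lra.
    by rewrite -kE; ring.
  by rewrite ler_pM2l.
by move: H; lra.
Qed.

Definition slope s u v := (s v - s u) / (v - u).

Section Slopes.
Variables (D : set R) (s : R -> R).
Hypothesis cs : convex_function D (s : R^o -> R^o).

Lemma slope_le_mid x y z : D x -> D z -> x < y < z ->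
  slope s x y <= slope s y z.
Proof.
move=> Dx Dz xyz; have := convex_three_points cs Dx Dz xyz.
case/andP: xyz => xy yz H.
by rewrite /slope ler_pdivrMr ?subr_gt0// mulrAC ler_pdivlMr ?subr_gt0.
Qed.

Lemma slope_le_left x y z : D x -> D z -> x < y < z ->
  slope s x y <= slope s x z.
Proof.
move=> Dx Dz xyz; have := convex_three_points cs Dx Dz xyz.
case/andP: xyz => xy yz H; have xz := lt_trans xy yz.
rewrite /slope ler_pdivrMr ?subr_gt0// mulrAC ler_pdivlMr ?subr_gt0//.
by move: H; lra.
Qed.

Lemma slope_le_right x y z : D x -> D z -> x < y < z ->
  slope s x z <= slope s y z.
Proof.
move=> Dx Dz xyz; have := convex_three_points cs Dx Dz xyz.
case/andP: xyz => xy yz H; have xz := lt_trans xy yz.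
rewrite /slope ler_pdivrMr ?subr_gt0// mulrAC ler_pdivlMr ?subr_gt0//.
by move: H; lra.
Qed.

(** Left slopes at [x] lie below right slopes; either the supremum of the former
    is the infimum of the latter, which is then the derivative, or a rational
    separates them. *)
Lemma convex_derivable_or_kink a b x : `]a, b[%classic `<=` D -> a < x < b ->
  derivable s x 1 \/
  exists q : rat, (forall u, a < u < x -> slope s u x < ratr q) /\
                  (forall v, x < v < b -> ratr q < slope s x v).
Proof.
move=> abD /andP[ax xb].
have Dab y : a < y -> y < b -> D y.
  by move=> ay yb; apply: abD; rewrite /= in_itv/= ay.
pose S1 := [set slope s u x | u in `]a, x[%classic].
pose S2 := [set slope s x v | v in `]x, b[%classic].
have [u1 u1P] : exists u1, a < u1 < x.
  by exists ((a + x) / 2); rewrite midf_lt//= midf_lt.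
have [v1 v1P] : exists v1, x < v1 < b.
  by exists ((x + b) / 2); rewrite midf_lt//= midf_lt.
have S12 u v : a < u < x -> x < v < b -> slope s u x <= slope s x v.
  move=> /andP[au ux] /andP[xv vb]; apply: slope_le_mid; last by rewrite ux.
    by apply: Dab => //; exact: lt_trans xb.
  by apply: Dab => //; exact: lt_trans xv.
have hS1 : has_sup S1.
  split; first by exists (slope s u1 x); exists u1 => //; rewrite /= in_itv.
  exists (slope s x v1) => _ [u /= + <-]; rewrite in_itv/= => uP.
  exact: S12.
have hS2 : has_inf S2.
  split; first by exists (slope s x v1); exists v1 => //; rewrite /= in_itv.
  exists (slope s u1 x) => _ [u /= + <-]; rewrite in_itv/= => uP.
  exact: S12.
have ltS1 u : a < u < x -> slope s u x <= sup S1.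
  move=> uP; apply: ub_le_sup; first by case: hS1.
  by exists u => //; rewrite /= in_itv.
have ltS2 v : x < v < b -> inf S2 <= slope s x v.
  move=> vP; apply: ge_inf; first by case: hS2.
  by exists v => //; rewrite /= in_itv.
have [lt12|le21] := ltP (sup S1) (inf S2).
  right; have [q] := rat_in_itvoo lt12; rewrite in_itv/= => /andP[q1 q2].
  exists q; split=> [u uP|v vP]; first exact: le_lt_trans (ltS1 _ uP) q1.
  exact: lt_le_trans q2 (ltS2 _ vP).
left; apply/cvg_ex; exists (sup S1 : R^o).
apply/cvgrPdist_le => /= e e0.
have [_ [u0 /= + <-] su0] := sup_adherent e0 hS1.
rewrite in_itv/= => /andP[au0 u0x].
have [_ [v0 /= + <-] sv0] := inf_adherent e0 hS2.
rewrite in_itv/= => /andP[xv0 v0b].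
near=> h.
have h0 : h != 0 by near: h; exact: nbhs_dnbhs_neq.
have hu : `|h| < x - u0.
  near: h; apply: dnbhs0_lt; by rewrite subr_gt0.
have hv : `|h| < v0 - x.
  near: h; apply: dnbhs0_lt; by rewrite subr_gt0.
rewrite [h *: 1]mulr1; case: (ltgtP h 0) h0 => // [hn|hp] _.
  rewrite ltr0_norm// in hu.
  have E : h^-1 *: (s (h + x) - s x) = slope s (h + x) x.
    rewrite /slope opprD addrCA subrr addr0 invrN mulrN -mulNr opprB.
    by rewrite mulrC.
  rewrite E; have uP : a < h + x < x by move: hu; rewrite -(ltrD2r x); lra.
  have := ltS1 _ uP.
  have := @slope_le_right u0 (h + x) x (Dab _ au0 (lt_trans u0x xb)) (Dab _ ax xb).
  have -> : u0 < h + x < x by apply/andP; split; lra.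
  move=> /(_ isT) A B; rewrite ger0_norm ?subr_ge0//.
  by lra.
rewrite gtr0_norm// in hv.
have E : h^-1 *: (s (h + x) - s x) = slope s x (h + x).
  by rewrite /slope addrK mulrC.
rewrite E; have vP : x < h + x < b by apply/andP; split; lra.
have A0 : sup S1 <= slope s x (h + x).
  apply: ge_sup; first by case: hS1.
  by move=> _ [u /= + <-]; rewrite in_itv/= => uP; exact: S12.
have := @slope_le_left x (h + x) v0 (Dab _ ax xb) (Dab _ (lt_trans ax xv0) v0b).
have -> : x < h + x < v0 by apply/andP; split; lra.
move=> /(_ isT) A; rewrite ler0_norm ?subr_le0//.
by lra.
Unshelve. all: by end_near.
Qed.

End Slopes.

Lemma countable_rat_labels (A : set R) (P : R -> rat -> Prop) :
  (forall x, A x -> exists q, P x q) ->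
  (forall x y q, A x -> A y -> P x q -> P y q -> x = y) ->
  countable A.
Proof.
move=> Pex Pinj.
have [f fP] : {f : R -> rat | forall x, A x -> P x (f x)}.
  apply: cid; exists (fun x => xget 0 [set q | P x q]) => x /Pex[q Pq].
  by have := @xgetPex _ 0 [set q | P x q]; apply; exists q.
apply/countable_injP.
exists (pickle \o f) => x y; rewrite !inE => Ax Ay /= /(pcan_inj pickleK) fxy.
by apply: (Pinj x y (f x)) => //; [exact: fP|rewrite fxy; exact: fP].
Qed.

(** Slopes increase from left to right, so the rational gaps at two kinks are
    disjoint: the kinks are countable and cannot fill an interval of positive
    length. *)
Lemma convex_derivable_point (D : set R) s a b :
  convex_function D (s : R^o -> R^o) -> a < b -> `]a, b[%classic `<=` D ->
  exists2 x, a < x < b & derivable s x 1.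
Proof.
move=> cs ab abD; apply: contrapT => nd.
have : countable `]a, b[%classic.
  apply: (@countable_rat_labels _ (fun x q =>
    (forall u, a < u < x -> slope s u x < ratr q) /\
    (forall v, x < v < b -> ratr q < slope s x v))).
    move=> x; rewrite /= in_itv/= => xab.
    have [dx|//] := convex_derivable_or_kink cs abD xab.
    by exfalso; apply: nd; exists x.
  have W x y q : x < y -> a < x < b -> a < y < b ->
    (forall v, x < v < b -> ratr q < slope s x v) ->
    (forall u, a < u < y -> slope s u y < ratr q) -> False.
    move=> xy /andP[ax xb] /andP[ay yb] /(_ y) + /(_ x).
    rewrite xy yb ax => /(_ isT) A /(_ isT) B.
    by have := lt_trans A B; rewrite ltxx.
  move=> x y q /=; rewrite !in_itv/= => xab yab [xu xv] [yu yv].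
  by case: (ltgtP x y) => // [/W|/W]; [move/(_ q xab yab xv yu)|move/(_ q yab xab yv xu)].
move/countable_lebesgue_measure0.
rewrite lebesgue_measure_itv/= lte_fin ab -EFinB => /eqP.
by rewrite eqe subr_eq0 gt_eqF.
Qed.

End Convex.

(** * Incidence algebra of the network *)

Section Dot.
Variable R : realType.

Lemma dotE n (a b : 'cV[R]_n) : dot a b = \sum_i a i 0 * b i 0.
Proof. by rewrite /dot mxE; apply: eq_bigr => i _; rewrite mxE. Qed.

Lemma dotC n (a b : 'cV[R]_n) : dot a b = dot b a.
Proof. by rewrite !dotE; apply: eq_bigr => i _; rewrite mulrC. Qed.

Lemma dotDl n (a b x : 'cV[R]_n) : dot (a + b) x = dot a x + dot b x.
Proof. by rewrite /dot linearD mulmxDl mxE. Qed.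

Lemma dotNl n (a x : 'cV[R]_n) : dot (- a) x = - dot a x.
Proof. by rewrite /dot linearN mulNmx mxE. Qed.

Lemma dotDr n (a x y : 'cV[R]_n) : dot a (x + y) = dot a x + dot a y.
Proof. by rewrite /dot mulmxDr mxE. Qed.

Lemma dotNr n (a x : 'cV[R]_n) : dot a (- x) = - dot a x.
Proof. by rewrite /dot mulmxN mxE. Qed.

Lemma dot_trmx m n (B : 'M[R]_(m, n)) a x : dot (B^T *m a) x = dot a (B *m x).
Proof. by rewrite /dot trmx_mul trmxK mulmxA. Qed.

Lemma dot_ge0 n (a b : 'cV[R]_n) : nonneg a -> nonneg b -> 0 <= dot a b.
Proof. by move=> a0 b0; rewrite dotE sumr_ge0// => i _; rewrite mulr_ge0. Qed.

Lemma dot_eq0 n (a b : 'cV[R]_n) : nonneg a -> nonneg b ->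
  dot a b = 0 <-> forall i, a i 0 * b i 0 = 0.
Proof.
move=> a0 b0; rewrite dotE; split=> [/eqP|ab0]; last by rewrite big1.
rewrite psumr_eq0 => [/allP ab i|i _]; last by rewrite mulr_ge0.
by apply/eqP; apply: ab; rewrite mem_index_enum.
Qed.

Lemma perp_eq0 n (a b : 'cV[R]_n) : perp a b -> forall i, a i 0 * b i 0 = 0.
Proof. by move=> [a0 b0 /dot_eq0]; apply. Qed.

Lemma perp_eq0l n (a b : 'cV[R]_n) i : perp a b -> 0 < b i 0 -> a i 0 = 0.
Proof. by move=> /perp_eq0/(_ i)/eqP; rewrite mulf_eq0 => /orP[/eqP//|/eqP ->]; rewrite ltxx. Qed.

End Dot.

Section Network.
Variables (R : realType) (N L : nat) (G : network R N L).
Local Notation A := (incidence G).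
Local Notation Ap := (incidence_pos G).
Local Notation M := (capacity_mx G).
Local Notation mu := (capacity G).
Local Notation c := (free_time G).

Definition node_value (p : 'cV[R]_N) (x : option 'I_N) : R :=
  if x is Some i then p i 0 else 0.

Lemma node_valueE p x : node_value p x = \sum_k (x == Some k)%:R * p k 0.
Proof.
case: x => [i|] /=; last by rewrite big1// => k _; rewrite mul0r.
rewrite (bigD1 i)//= eqxx mul1r big1 ?addr0// => k ki.
by rewrite (inj_eq Some_inj) eq_sym (negbTE ki) mul0r.
Qed.

Lemma incidence_tr_mulE p e :
  (A^T *m p) e 0 = node_value p (link G e).1 - node_value p (link G e).2.
Proof.
rewrite !node_valueE -sumrB mxE; apply: eq_bigr => k _.
by rewrite !mxE mulrBl.
Qed.

Lemma incidence_pos_tr_mulE p e : (Ap^T *m p) e 0 = node_value p (link G e).1.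
Proof.
rewrite node_valueE mxE; apply: eq_bigr => k _; congr (_ * _); rewrite !mxE.
have := link_neq G e; case: ((link G e).1 =P Some k) => [->|_] h.
  by rewrite [_ == Some k]eq_sym (negbTE h) subr0; apply/max_idPr.
by rewrite sub0r; apply/max_idPl; rewrite oppr_le0.
Qed.

Lemma capacity_mulE (v : 'cV[R]_L) e : (M *m v) e 0 = mu e 0 * v e 0.
Proof. by rewrite mul_diag_mx !mxE. Qed.

Lemma incidence_mulE (y : 'cV[R]_L) i : (A *m y) i 0 =
  \sum_(e | (link G e).1 == Some i) y e 0 -
  \sum_(e | (link G e).2 == Some i) y e 0.
Proof.
rewrite mxE (big_mkcond (fun e => _ == _)) [X in _ - X]big_mkcond -sumrB.
apply: eq_bigr => e _; rewrite !mxE mulrBl.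
by case: eqP; case: eqP; rewrite /= ?(mul0r, mul1r).
Qed.

(** The upper bound on link flows in the flow program: the rate at which a queue
    with delay rate [w'] discharges, per unit of destination arrival time. *)
Definition queue_outflow (w' : 'cV[R]_L) (p' : 'cV[R]_N) : 'cV[R]_L :=
  M *m (w' - Ap^T *m p' + const_mx 1).

Lemma queue_outflowE w' p' e :
  queue_outflow w' p' e 0 =
  mu e 0 * (w' e 0 - node_value p' (link G e).1 + 1).
Proof. by rewrite capacity_mulE !mxE -incidence_pos_tr_mulE mxE. Qed.

Lemma queue_outflow_capacity w' p' :
  queue_outflow w' p' = M *m w' - M *m Ap^T *m p' + mu.
Proof.
rewrite /queue_outflow mulmxDr mulmxBr mulmxA; congr (_ + _).
by apply/colP => e; rewrite capacity_mulE !mxE mulr1.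
Qed.

(** The integrand of the objective [ZF], in which the demand term of the dual
    value has been written as the integral of [dot rho q]. *)
Definition gap_density (s : R) (q : 'cV[R]_N) (y w w' : 'cV[R]_L)
    (p' rho : 'cV[R]_N) : R :=
  dot (const_mx s) q + dot c y + dot w (M *m w') -
  dot w (M *m Ap^T *m p') + dot mu w - dot rho q.

(** The travel times appear in the link product and in the origin product, where
    conservation of flow cancels them; the terms in [w] and [y] cancel between
    the link product and the delay product. *)
Lemma gap_densityE s q y w w' p p' rho : A *m y - q = 0 ->
  gap_density s q y w w' p' rho =
  dot (w - A^T *m p + c) y + dot w (queue_outflow w' p' - y) +
  dot (p + const_mx s - rho) q.
Proof.
move=> /eqP; rewrite subr_eq0 => /eqP qE.
rewrite queue_outflow_capacity /gap_density !(dotDl, dotNl, dotDr, dotNr).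
rewrite dot_trmx qE (dotC w mu); ring.
Qed.

Lemma earliest_travel_time_unique (T : interval R) w w1 p p1 :
  (forall t, t \in T -> w t = w1 t) ->
  earliest_travel_time G T w p -> earliest_travel_time G T w1 p1 ->
  forall t, t \in T -> p t = p1 t.
Proof.
move=> ww ep ep1 t tT; apply/colP => i.
have [[r ri pE] ple] := ep t tT i; have [[r1 r1i p1E] p1le] := ep1 t tT i.
by apply/eqP; rewrite eq_le {1}p1E -ww// ple//= pE ww// p1le.
Qed.

End Network.

(** * The duality gap *)

Section Gap.
Variables (R : realType) (N L : nat) (G : network R N L).
Variables (T : interval R) (s : R -> R).
Local Notation A := (incidence G).
Local Notation Ap := (incidence_pos G).
Local Notation M := (capacity_mx G).
Local Notation c := (free_time G).
Local Notation Q := (demand G).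
Local Notation TT := [set` T].

Lemma derive1_coord n (f : R -> 'cV[R]_n) t i : derivable f t 1 ->
  derivable (fun u => f u i 0) t 1 /\
  derive1 f t i 0 = derive1 (fun u => f u i 0) t.
Proof.
move=> df; split; first by move/derivable_mxP : df.
by rewrite !derive1E derive_mx// mxE.
Qed.

Lemma ae_derivable_mx n (f : R -> 'cV[R]_n) :
  (forall i, absolutely_continuous TT (fun t => f t i 0)) ->
  {ae @lebesgue_measure R, forall t, TT t -> TT° t /\ derivable f t 1}.
Proof.
move=> acf.
have H : {ae @lebesgue_measure R, forall t, forall i, TT° t ->
    derivable (fun t => f t i 0) t 1}.
  by apply: filter_forall => i; have [] := acf i.
apply: filterS2 H (ae_interior_itv T) => t Ht Tt /Tt Tt'; split => //.
by apply/derivable_mxP => i j; rewrite ord1; exact: Ht.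
Qed.

Lemma ae_regular_derivable w p : regular_delay G T w p ->
  {ae @lebesgue_measure R, forall t, TT t ->
    [/\ TT° t, derivable w t 1 & derivable p t 1]}.
Proof.
move=> [acw acp _ _ _].
apply: filterS2 (ae_derivable_mx acw) (ae_derivable_mx acp) => t Hw Hp Tt.
by have [? ?] := Hw Tt; have [_ ?] := Hp Tt.
Qed.

Let mT : measurable TT.
Proof. exact: measurable_itv. Qed.

Lemma lebesgue_integrable_dot n (f g : R -> 'cV[R]_n) :
  (forall i, lebesgue_integrable TT (fun t => f t i 0 * g t i 0)) ->
  lebesgue_integrable TT (fun t => dot (f t) (g t)).
Proof.
move=> fg; have [] := has_integral_sum mT (fun i => conj (fg i) erefl).
move=> [h hi sh] _; exists h => //.
by apply: filterS sh => t sh Tt; rewrite -sh// dotE.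
Qed.

Lemma has_integral_dot_cst n (a : 'cV[R]_n) (f : R -> 'cV[R]_n) :
  (forall i, lebesgue_integrable TT (fun t => f t i 0)) ->
  has_integral TT (fun t => dot a (f t)) (dot a (vintegral TT f)).
Proof.
move=> fi; rewrite dotE.
apply: (eq_has_integral (g := fun t => \sum_i a i 0 * f t i 0) mT).
  by move=> t _; rewrite dotE.
by apply: has_integral_sum => // i; rewrite mxE; exact: has_integralZ.
Qed.

Lemma has_integral_gap q y w p rho :
  regular_flow T s q y -> regular_delay G T w p -> vintegral TT q = Q ->
  has_integral TT (fun t => gap_density G (s t) (q t) (y t) (w t)
                              (derive1 w t) (derive1 p t) rho)
    (ZF G T s w p rho q y).
Proof.
move=> [qi sqi yi] [_ _ wi wwi wpi] qQ.
rewrite /ZF /ZP /ZQ /ZD -qQ.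
have -> : forall a b c d e f : R, a + b + (c - d) - (- e + f) =
   a + b + c - d + e - f by move=> *; ring.
apply: has_integralB => //; last by rewrite dotC; exact: has_integral_dot_cst.
apply: has_integralD => //; first apply: has_integralB => //.
- apply: has_integralD => //; first apply: has_integralD => //; split=> //.
  + apply: lebesgue_integrable_dot => i.
    by apply: (eq_lebesgue_integrable mT _ (sqi i)) => t _; rewrite mxE.
  + by have [] := has_integral_dot_cst c yi.
  + apply: lebesgue_integrable_dot => e.
    apply: (eq_lebesgue_integrable mT _
      (lebesgue_integrableZ (capacity G e 0) mT (wwi e))).
    by move=> t _; rewrite capacity_mulE mulrCA.
- split=> //; apply: lebesgue_integrable_dot => e.
  apply: (eq_lebesgue_integrable mT _
    (lebesgue_integrableZ (capacity G e 0) mT (wpi e))).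
  by move=> t _; rewrite -mulmxA capacity_mulE mulrCA.
- by split=> //; have [] := has_integral_dot_cst (capacity G) wi.
Qed.

Lemma gap_density_ge0 q y w p rho :
  (forall t, t \in T -> [/\ nonneg (w t), nonneg (w t - A^T *m p t + c) &
     nonneg (p t + sched N s t - rho)]) ->
  regular_delay G T w p -> flow_lp_feasible G T s w p q y ->
  {ae @lebesgue_measure R, forall t, TT t ->
   [/\ nonneg (queue_outflow G (derive1 w t) (derive1 p t) - y t) &
    0 <= gap_density G (s t) (q t) (y t) (w t) (derive1 w t) (derive1 p t) rho]}.
Proof.
move=> dual reg [_ qy0 _ Aq cap].
apply: filterS (ae_regular_derivable reg) => t + Tt => /(_ Tt)[T't dw dp].
have [w0 wp0 ps0] := dual t Tt; have [q0 y0] := qy0 t Tt.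
have out0 : nonneg (queue_outflow G (derive1 w t) (derive1 p t) - y t).
  exact: cap.
split => //; rewrite (gap_densityE _ _ _ (p t) _ _ (Aq t Tt)).
by rewrite !addr_ge0// dot_ge0.
Qed.

Lemma weak_duality q y w p rho :
  (forall t, t \in T -> [/\ nonneg (w t), nonneg (w t - A^T *m p t + c) &
     nonneg (p t + sched N s t - rho)]) ->
  regular_delay G T w p -> flow_lp_feasible G T s w p q y ->
  0 <= ZF G T s w p rho q y.
Proof.
move=> dual reg feas; have [regf _ qQ _ _] := feas.
apply: (has_integral_ge0 mT _ (has_integral_gap rho regf reg qQ)).
by apply: filterS (gap_density_ge0 dual reg feas) => t + Tt => /(_ Tt)[].
Qed.

End Gap.

(** * Demand costs *)

Section DemandCost.
Variables (R : realType) (N L : nat) (G : network R N L).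
Variables (T : interval R) (s : R -> R).
Local Notation A := (incidence G).
Local Notation c := (free_time G).
Local Notation Q := (demand G).
Local Notation TT := [set` T].

(** An origin with positive demand sends flow at some time, and there [rho] is
    attained by the travel cost that [rho1] bounds from below. *)
Lemma demand_cost_le (q : R -> 'cV[R]_N) (p : R -> 'cV[R]_N) rho rho1 i :
  (forall t, t \in T -> perp (p t + sched N s t - rho) (q t)) ->
  (forall t, t \in T -> nonneg (p t + sched N s t - rho1)) ->
  vintegral TT q = Q -> rho1 i 0 * Q i 0 <= rho i 0 * Q i 0.
Proof.
move=> pq p1 qQ.
have [[t [tT qt]]|nq] := pselect (exists t, t \in T /\ q t i 0 <> 0).
  rewrite ler_wpM2r ?demand_ge0//.
  have [_ q0 _] := pq t tT.
  have : 0 < q t i 0 by rewrite lt_neqAle q0 eq_sym andbT; exact/eqP.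
  move=> /(perp_eq0l (pq t tT)); have := p1 t tT i; rewrite !mxE.
  by move=> h1 h2; lra.
suff -> : Q i 0 = 0 by rewrite !mulr0.
rewrite -qQ mxE /Rintegral (_ : (\int[_]_(t in _) _)%E = 0%E)//.
apply: integral0_eq => t Tt; congr EFin.
by apply: contrapT => qt; apply: nq; exists t.
Qed.

Lemma demand_cost_unique (q q1 : R -> 'cV[R]_N) (p : R -> 'cV[R]_N) rho rho1 :
  (forall t, t \in T -> perp (p t + sched N s t - rho) (q t)) ->
  (forall t, t \in T -> perp (p t + sched N s t - rho1) (q1 t)) ->
  vintegral TT q = Q -> vintegral TT q1 = Q -> dot Q rho = dot Q rho1.
Proof.
move=> pq pq1 qQ q1Q; rewrite !dotE; apply: eq_bigr => i _.
rewrite ![Q i 0 * _]mulrC.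
apply/eqP; rewrite eq_le; apply/andP; split.
- by apply: (demand_cost_le i pq1 _ q1Q) => t /pq[].
- by apply: (demand_cost_le i pq _ qQ) => t /pq1[].
Qed.

End DemandCost.

(** * From equilibrium to a zero gap *)

Section Necessity.
Variables (R : realType) (N L : nat) (G : network R N L).
Variables (T : interval R) (s : R -> R).
Local Notation A := (incidence G).
Local Notation c := (free_time G).
Local Notation Q := (demand G).
Local Notation TT := [set` T].

Lemma derive1_eq_on n (f g : R -> 'cV[R]_n) t :
  (forall u, u \in T -> f u = g u) -> TT° t -> derivable f t 1 ->
  derivable g t 1 /\ derive1 f t = derive1 g t.
Proof.
move=> fg T't df.
have fg' : \near t, f t = g t.
  by move: T't; rewrite /interior; apply: filterS => u Tu; exact: fg.
split; first by apply: near_eq_derivable df.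
by rewrite !derive1E; apply: near_eq_derive.
Qed.

(** The equilibrium flows themselves are optimal: complementarity annihilates
    the gap integrand, and the gap is never negative. *)
Lemma gqrp_flow_lp_solution qC yC wC piC rhoC :
  cost_solution G T s qC yC wC piC rhoC -> gqrp G T s wC ->
  exists qF yF, flow_lp_solution G T s wC piC rhoC qF yF /\
                ZF G T s wC piC rhoC qF yF = 0.
Proof.
move=> [[varsC qCQ lcpC] ettC regfC regdC].
move=> [q [y [w [p [rho [[[vars qQ queue _ lcp] ett regf regd] ww]]]]]].
have wwC t : t \in T -> wC t = w t by move=> tT; rewrite ww.
have ppC t : t \in T -> piC t = p t.
  exact: (earliest_travel_time_unique wwC ettC ett).
have dual t : t \in T -> [/\ nonneg (wC t), nonneg (wC t - A^T *m piC t + c) &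
     nonneg (piC t + sched N s t - rhoC)].
  move=> tT; have [/(_ t tT)[_ _ w0 _] _] := varsC.
  by have [_ _ [] ? _ _ []] := lcpC t tT.
have due t : TT t -> TT° t -> derivable wC t 1 -> derivable piC t 1 ->
    perp (queue_outflow G (derive1 wC t) (derive1 piC t) - y t) (w t).
  move=> Tt T't dwC dpC; rewrite queue_outflow_capacity.
  have [dw ->] := derive1_eq_on wwC T't dwC.
  by have [dp ->] := derive1_eq_on ppC T't dpC; exact: queue.
have feas : flow_lp_feasible G T s wC piC q y.
  split=> //.
  - by move=> t tT; have [/(_ t tT)[] ] := vars.
  - by move=> t tT; have [] := lcp t tT.
  - by move=> t T't dwC dpC; have [] := due t (interior_subset T't) T't dwC dpC.
have ZF0 : ZF G T s wC piC rhoC q y = 0.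
  have -> : ZF G T s wC piC rhoC q y = ZF G T s wC piC rho q y.
    rewrite /ZF /ZD (@demand_cost_unique _ _ _ G T s qC q piC rhoC rho)//.
      by move=> t /lcpC[].
    by move=> t tT; rewrite ppC//; have [] := lcp t tT.
  have [_ <-] := has_integral_gap rho regf regdC qQ.
  suff [] : has_integral TT (fun t => gap_density G (s t) (q t) (y t) (wC t)
                            (derive1 wC t) (derive1 piC t) rho) 0 by [].
  have mT : measurable TT by exact: measurable_itv.
  apply: (has_integral_ae mT _ (has_integral0 mT)).
  apply: filterS (ae_regular_derivable regdC) => t + Tt => /(_ Tt)[T't dwC dpC].
  have [Aq [_ _ wy] [_ _ pq]] := lcp t Tt.
  rewrite (gap_densityE _ _ _ (p t) _ _ Aq) wwC// wy pq dotC.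
  by have [_ _ ->] := due t Tt T't dwC dpC; rewrite !addr0.
exists q, y; split=> //; split=> // q' y' feas'.
by rewrite ZF0; exact: (weak_duality dual regdC feas').
Qed.

End Necessity.

(** * The slope of the travel times *)

Section Schedule.
Variables (R : realType) (T : interval R) (s : R -> R).
Local Notation TT := [set` T].

(** Take a point [x] just left of [u] where [s] is differentiable; by convexity
    the slope of the chord from [u] to [t] is at least the derivative at [x],
    which exceeds -1. *)
Lemma schedule_slope tP u t : schedule_cost T s tP ->
  TT° u -> TT t -> u < t -> s u - s t < t - u.
Proof.
move=> [_ _ cs ds] T'u Tt ut; have Tu := interior_subset T'u.
have [e e0 eT] := interior_itvP T'u.
have Tue : TT (u - e) by apply: eT; rewrite addrAC subrr add0r normrN gtr0_norm.
have ueu : u - e < u by rewrite ltrBlDr ltrDl.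
have [x /andP[uex xu] dx] : exists2 x, u - e < x < u & derivable s x 1.
  apply: (convex_derivable_point cs ueu) => x /=; rewrite in_itv/= => /andP[ux xu].
  by apply: (itv_between Tue Tu); rewrite !ltW.
have T'x : TT° x by apply: (itv_betweenoo Tue Tu); rewrite uex.
have Tx := interior_subset T'x.
have d1 := ds x T'x dx.
have sxu : derive1 s x <= slope s x u.
  apply: (derive1_le_right (e := u - x) dx); first by rewrite subr_gt0.
  move=> h /andP[h0]; rewrite le_eqVlt => /predU1P[->|hu].
    rewrite [x + _]addrC subrK /slope divfK//.
    by rewrite gt_eqF// subr_gt0.
  have := slope_le_left cs Tx Tu (y := x + h).
  have -> : x < x + h < u by apply/andP; split; lra.
  move=> /(_ isT); rewrite {1}/slope addrAC subrr add0r.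
  by rewrite ler_pdivrMr.
have sut : slope s x u <= slope s u t by apply: (slope_le_mid cs) => //; rewrite xu.
have := lt_le_trans d1 (le_trans sxu sut).
by rewrite /slope ltr_pdivlMr ?subr_gt0// mulN1r => ?; lra.
Qed.

End Schedule.

Section TravelTimeSlope.
Variables (R : realType) (N L : nat) (G : network R N L).
Variables (T : interval R) (s : R -> R) (tP : R).
Hypothesis hs : schedule_cost T s tP.
Variables (q : R -> 'cV[R]_N) (y w : R -> 'cV[R]_L) (p : R -> 'cV[R]_N).
Variable rho : 'cV[R]_N.
Local Notation A := (incidence G).
Local Notation c := (free_time G).
Local Notation TT := [set` T].
Hypothesis cost : cost_lcp G T s q y w p rho.
Hypothesis ett : earliest_travel_time G T w p.

Lemma derivable_node_value x t : derivable p t 1 ->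
  derivable (fun u => node_value (p u) x) t 1 /\
  node_value (derive1 p t) x = derive1 (fun u => node_value (p u) x) t.
Proof.
move=> dp; case: x => [i|] /=; first exact: derive1_coord.
split; first exact: derivable_cst.
by rewrite derive1E derive_cst.
Qed.

Definition slack (t : R) (e : 'I_L) := (w t - A^T *m p t + c) e 0.

Lemma slackE t e : slack t e = w t e 0 + c e 0 -
  node_value (p t) (link G e).1 + node_value (p t) (link G e).2.
Proof.
rewrite /slack 2!mxE [X in _ + X + _]mxE incidence_tr_mulE; ring.
Qed.

Lemma slack_ge0 t e : t \in T -> 0 <= slack t e.
Proof. by case: cost => _ _ lcp /lcp[_ _ [+ _ _] _]; apply. Qed.

Lemma delay_ge0 t e : t \in T -> 0 <= w t e 0.
Proof. by case: cost => -[vars _] _ _ /vars[_ _ + _]; apply. Qed.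

(** The slack is nonnegative and vanishes at [t], so [t] is a minimum of it. *)
Lemma tight_derive t e : TT° t -> derivable w t 1 -> derivable p t 1 ->
  slack t e = 0 ->
  derive1 w t e 0 = node_value (derive1 p t) (link G e).1 -
                    node_value (derive1 p t) (link G e).2.
Proof.
move=> T't dw dp st0.
have [dwe ->] := derive1_coord e dw.
have [dp1 ->] := derivable_node_value (link G e).1 dp.
have [dp2 ->] := derivable_node_value (link G e).2 dp.
have [r r0 rT] := interior_itvP T't.
pose f u := (node_value (p u) (link G e).1 - node_value (p u) (link G e).2)
            - w u e 0.
have df : derivable f t 1 by apply: derivableB => //; exact: derivableB.
have : derive1 f t = 0.
  apply: (derive1_local_max df r0) => u ur.
  have := slack_ge0 e (rT u ur); move: st0; rewrite !slackE /f; lra.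
rewrite !derive1E /f deriveB//; last exact: derivableB.
by rewrite deriveB// => H; lra.
Qed.

Lemma derive_delay0 t e : TT° t -> derivable w t 1 -> w t e 0 = 0 ->
  derive1 w t e 0 = 0.
Proof.
move=> T't dw w0; have [dwe ->] := derive1_coord e dw.
have [r r0 rT] := interior_itvP T't.
have dn : derivable (fun u => - w u e 0) t 1 by exact: derivableN.
have : derive1 (fun u => - w u e 0) t = 0.
  by apply: (derive1_local_max dn r0) => u ur; rewrite w0 oppr0 oppr_le0 delay_ge0//; exact: rT.
by rewrite !derive1E deriveN// => /eqP; rewrite oppr_eq0 => /eqP.
Qed.

Lemma route_time_ge0 t r : t \in T -> 0 <= route_time G (w t) r.
Proof.
move=> tT; apply: sumr_ge0 => e _.
by rewrite addr_ge0 ?free_time_ge0 ?delay_ge0.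
Qed.

Lemma tight_link t i : t \in T ->
  exists2 e, (link G e).1 = Some i & slack t e = 0.
Proof.
move=> tT; have [[[//|e r] /= /andP[/eqP e1 re] pE] _] := ett tT i.
exists e => //; apply/eqP; rewrite eq_le slack_ge0// andbT slackE e1 /= pE.
rewrite /route_time big_cons.
suff : node_value (p t) (link G e).2 <= route_time G (w t) r.
  by rewrite /route_time; lra.
case: (link G e).2 re => [k|] re /=; last exact: route_time_ge0.
by have [_] := ett tT k; apply.
Qed.

(** A nonnegative outflow says that the delay of a link grows at least as fast as
    the travel time of its tail less 1, so the head of a tight link has a travel
    time of slope at most 1. Now take the first link of a shortest route from
    [i]. If it has no delay, the travel times of [i] and of its head grow
    equally fast. If it has a queue, the cost solution saturates it, and the
    flow on it either comes through a tight link with head [i] or departs from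
    [i]; in the latter case the cost of origin [i] is minimal at [t], so its
    travel time rises no faster than the schedule cost falls, at a rate
    below 1. *)
Lemma derive_travel_time_le1_at t i :
  TT° t -> derivable w t 1 -> derivable p t 1 ->
  nonneg (queue_outflow G (derive1 w t) (derive1 p t)) ->
  derive1 p t i 0 <= 1.
Proof.
move=> T't dw dp out0; have tT : t \in T := interior_subset T't.
have head e : slack t e = 0 -> node_value (derive1 p t) (link G e).2 <= 1.
  move=> /(tight_derive T't dw dp) we; have := out0 e.
  by rewrite queue_outflowE pmulr_rge0 ?capacity_gt0// we; lra.
have [e e1 se] := tight_link i tT.
have [w0|w0] := eqVneq (w t e 0) 0.
  have := tight_derive T't dw dp se; rewrite (derive_delay0 T't dw w0) e1 /=.
  by have := head e se; lra.
have {}w0 : 0 < w t e 0 by rewrite lt_neqAle eq_sym w0 delay_ge0.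
have [_ _ /(_ t tT)[Aq muw wy pq]] := cost.
have ye : 0 < y t e 0.
  have := perp_eq0l muw w0; rewrite !mxE => /eqP; rewrite subr_eq0 => /eqP <-.
  exact: capacity_gt0.
have y0 e' : 0 <= y t e' 0 by case: wy => _ + _; apply.
(* The saturated link [e] is fed by an upstream link or by the origin [i]. *)
have [[e' [e'i ye']]|noin] :=
    pselect (exists e', (link G e').2 = Some i /\ 0 < y t e' 0).
  by have := head e' (perp_eq0l wy ye'); rewrite e'i.
have qi : 0 < q t i 0.
  move/eqP: Aq; rewrite subr_eq0 => /eqP <-; rewrite incidence_mulE.
  rewrite [X in _ - X]big1 => [|e' /eqP e'i]; last first.
    apply/eqP; rewrite eq_le y0 andbT leNgt; apply/negP => ye'.
    by apply: noin; exists e'.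
  rewrite subr0 (bigD1 e) ?e1//=; apply: ltr_wpDr => //.
  by apply: sumr_ge0 => e' _.
have pi0 := perp_eq0l pq qi.
have [dpi ->] := derive1_coord i dp.
have [r r0 rT] := interior_itvP T't.
(* Half of [r], so that [t - h] stays in the interior. *)
have r20 : 0 < r / 2 by rewrite divr_gt0.
apply: (derive1_le_left dpi r20) => h /andP[h0 hr].
have T'h : TT° (t - h).
  apply: (@itv_betweenoo _ _ (t - r) t).
  - by apply: rT; rewrite addrAC subrr add0r normrN gtr0_norm.
  - exact: tT.
  - by apply/andP; split; lra.
have th : t - h < t by lra.
have := schedule_slope hs T'h tT th.
have [_ _ /(_ (t - h) (interior_subset T'h))[_ _ _ [/(_ i) + _ _]]] := cost.
by move: pi0; rewrite !mxE mul1r; lra.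
Qed.

End TravelTimeSlope.

(** * Averaging the flow at a point *)

Section AbsolutelyContinuous.
Variables (R : realType) (T : interval R).
Local Notation TT := [set` T].

Lemma absolutely_continuous_integral f a b : absolutely_continuous TT f ->
  TT a -> TT b -> a <= b -> has_integral `[a, b] (derive1 f) (f b - f a).
Proof. by move=> [_ ftc] Ta Tb ab; have [? ->] := ftc a b Ta Tb ab. Qed.

Lemma itv_subset a b : TT a -> TT b -> `[a, b]%classic `<=` TT.
Proof. by move=> Ta Tb x; rewrite /= in_itv/=; exact: itv_between. Qed.

(** The bound passes from almost every point to every point because a
    difference quotient is an average of the derivative. *)
Lemma derive1_le_ae f k t : absolutely_continuous TT f ->
  {ae @lebesgue_measure R, forall u, TT u -> derive1 f u <= k} ->
  TT° t -> derivable f t 1 -> derive1 f t <= k.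
Proof.
move=> acf fk T't df; have [r r0 rT] := interior_itvP T't.
apply: (derive1_le_right df r0) => h /andP[h0 hr].
have Tt := interior_subset T't.
have Tth : TT (t + h) by apply: rT; rewrite addrAC subrr add0r gtr0_norm.
have tth : t <= t + h by rewrite lerDl ltW.
rewrite -[h in k * h](_ : t + h - t = h); last by ring.
apply: (has_integral_le _ _ (absolutely_continuous_integral acf Tt Tth tth)
  (has_integral_cst k tth)); first exact: measurable_itv.
by apply: filterS fk => u fk /(itv_subset Tt Tth); exact: fk.
Qed.

End AbsolutelyContinuous.

(** Limits along an ultrafilter stand for a convergent subsequence: all
    coordinates of a bounded family converge along the same filter. *)
Lemma ultra_cvg_bounded (R : realType) (X : Type) (U : set_system X)
    (f : X -> R) (a b : R) : UltraFilter U -> (\forall x \near U, a <= f x <= b) ->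
  exists l : R, f @ U --> l.
Proof.
move=> UU fab; have PU : ProperFilter U by exact: ultra_proper.
have [l [_ ll]] := @segment_compact R a b (f @ U) _ fab.
exists l => V Vl; rewrite /nbhs/=.
have [//|UC] := in_ultra_setVsetC (f @^-1` V) UU.
have [x [Cx Vx]] := ll (~` V) V UC Vl.
by exfalso; exact: Cx.
Qed.

Lemma derivable_gt0_near (R : realType) (f : R -> R) t :
  derivable f t 1 -> 0 < f t ->
  exists2 d, 0 < d & forall u, t <= u <= t + d -> 0 < f u.
Proof.
move=> /derivable1_diffP/differentiable_continuous cf ft.
have ngt : nbhs t [set u | 0 < f u] by exact: (cvgr_gt (f t) cf 0 ft).
move/nbhs_ballP: ngt => [e /= e0 eT].
exists (e / 2); first by rewrite divr_gt0.
move=> u /andP[tu ue]; apply: eT; rewrite /ball/= distrC ger0_norm ?subr_ge0//.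
lra.
Qed.

Section Averaging.
Variables (R : realType) (N L : nat) (G : network R N L).
Variables (T : interval R) (s : R -> R) (tP : R).
Hypothesis hs : schedule_cost T s tP.
Variables (q : R -> 'cV[R]_N) (y w : R -> 'cV[R]_L) (p : R -> 'cV[R]_N).
Variable rho : 'cV[R]_N.
Local Notation A := (incidence G).
Local Notation c := (free_time G).
Local Notation mu := (capacity G).
Local Notation TT := [set` T].
Hypothesis regd : regular_delay G T w p.
Hypothesis yi : forall e, lebesgue_integrable TT (fun t => y t e 0).
Hypothesis y0 : forall t, t \in T -> nonneg (y t).
Hypothesis q0 : forall t, t \in T -> nonneg (q t).
Hypothesis Aq : forall t, t \in T -> A *m y t - q t = 0.
Hypothesis dual : forall t, t \in T ->
  [/\ nonneg (w t), nonneg (w t - A^T *m p t + c) &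
      nonneg (p t + sched N s t - rho)].

Local Notation out t := (queue_outflow G (derive1 w t) (derive1 p t)).

Hypothesis compl : {ae @lebesgue_measure R, forall t, TT t ->
  [/\ nonneg (out t - y t), perp (out t - y t) (w t),
      perp (w t - A^T *m p t + c) (y t) &
      perp (p t + sched N s t - rho) (q t)]}.

Let mitv a b : measurable (`[a, b]%classic : set R).
Proof. exact: measurable_itv. Qed.

Definition average_flow t h e : R :=
  h^-1 * \int[@lebesgue_measure R]_(u in `[t, t + h]) y u e 0.

(** The mean of [queue_outflow] over [[t, t + h]], with the integrals of the
    derivatives already evaluated. *)
Definition average_outflow t h e : R :=
  mu e 0 * (h^-1 * (w (t + h) e 0 - w t e 0) -
    h^-1 * (node_value (p (t + h)) (link G e).1 -
            node_value (p t) (link G e).1) + 1).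

Section At.
Variables (t r : R).
Hypothesis Tt : TT t.
Hypothesis r0 : 0 < r.
Hypothesis rT : forall h, 0 < h <= r -> TT (t + h).

Let rsub h : 0 < h <= r -> `[t, t + h]%classic `<=` TT.
Proof. by move=> hr; apply: itv_subset => //; exact: rT. Qed.

Lemma has_integral_average h e : 0 < h <= r ->
  has_integral `[t, t + h] (fun u => y u e 0) (h * average_flow t h e).
Proof.
move=> hr; have h0 : h != 0 by case/andP: hr => h0 _; rewrite gt_eqF.
split; last by rewrite /average_flow mulVKf.
apply: (lebesgue_integrable_subset (measurable_itv T) (mitv _ _) (rsub hr)); exact: yi.
Qed.

Lemma has_integral_node_value h x : 0 < h <= r ->
  has_integral `[t, t + h] (derive1 (fun u => node_value (p u) x))
    (node_value (p (t + h)) x - node_value (p t) x).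
Proof.
move=> hr; have tth : t <= t + h by case/andP: hr => h0 _; rewrite lerDl ltW.
case: x => [i|] /=.
  have [_ acp _ _ _] := regd.
  exact: (absolutely_continuous_integral (acp i) Tt (rT hr) tth).
rewrite subrr; apply: (eq_has_integral (mitv _ _) _ (has_integral0 (mitv _ _))).
by move=> u _; rewrite derive1E derive_cst.
Qed.

Lemma has_integral_outflow h e : 0 < h <= r ->
  has_integral `[t, t + h] (fun u => out u e 0) (h * average_outflow t h e).
Proof.
move=> hr; have tth : t <= t + h by case/andP: hr => h0 _; rewrite lerDl ltW.
have h0 : h != 0 by case/andP: hr => h0 _; rewrite gt_eqF.
pose f u := mu e 0 * (derive1 (fun u => w u e 0) u -
  derive1 (fun u => node_value (p u) (link G e).1) u + 1).
have -> : h * average_outflow t h e = mu e 0 * (w (t + h) e 0 - w t e 0 -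
    (node_value (p (t + h)) (link G e).1 - node_value (p t) (link G e).1) +
    1 * (t + h - t)).
  by rewrite /average_outflow; field.
apply: (has_integral_ae (g := f) (mitv _ _)).
  apply: filterS (ae_regular_derivable regd) => u + /(rsub hr) Tu.
  move=> /(_ Tu)[_ dw dp]; rewrite queue_outflowE /f.
  have [_ ->] := derive1_coord e dw.
  by have [_ ->] := derivable_node_value (link G e).1 dp.
apply: has_integralZ => //; apply: has_integralD => //; last exact: has_integral_cst.
apply: has_integralB => //; last exact: has_integral_node_value.
have [acw _ _ _ _] := regd.
exact: (absolutely_continuous_integral (acw e) Tt (rT hr) tth).
Qed.

Lemma has_integral_origin h i : 0 < h <= r ->
  has_integral `[t, t + h] (fun u => q u i 0)
    (h * \sum_e A i e * average_flow t h e).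
Proof.
move=> hr; rewrite mulr_sumr.
apply: (eq_has_integral (g := fun u => \sum_e A i e * y u e 0) (mitv _ _)).
  move=> u /(rsub hr) Tu; have /eqP := Aq Tu.
  by rewrite subr_eq0 => /eqP <-; rewrite mxE.
apply: has_integral_sum => // e; rewrite mulrCA.
by apply: has_integralZ => //; exact: has_integral_average.
Qed.

Lemma average_flow_ge0 h e : 0 < h <= r -> 0 <= average_flow t h e.
Proof.
move=> hr; rewrite -(pmulr_rge0 _ (proj1 (andP hr))).
apply: (has_integral_ge0 (mitv _ _) _ (has_integral_average e hr)).
by apply: aeW => u /(rsub hr) Tu; exact: y0.
Qed.

Lemma average_origin_ge0 h i : 0 < h <= r ->
  0 <= \sum_e A i e * average_flow t h e.
Proof.
move=> hr; rewrite -(pmulr_rge0 _ (proj1 (andP hr))).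
apply: (has_integral_ge0 (mitv _ _) _ (has_integral_origin i hr)).
by apply: aeW => u /(rsub hr) Tu; exact: q0.
Qed.

Lemma average_flow_le h e : 0 < h <= r ->
  average_flow t h e <= average_outflow t h e.
Proof.
move=> hr; rewrite -(ler_pM2l (proj1 (andP hr))).
apply: (has_integral_le (mitv _ _) _ (has_integral_average e hr)
  (has_integral_outflow e hr)).
apply: filterS compl => u + /(rsub hr) Tu => /(_ Tu)[/(_ e) + _ _ _].
by rewrite !mxE subr_ge0.
Qed.

Lemma average_flow_queue h e : 0 < h <= r ->
  (forall u, t <= u <= t + h -> 0 < w u e 0) ->
  average_flow t h e = average_outflow t h e.
Proof.
move=> hr wpos; have h0 : h != 0 by case/andP: hr => h0 _; rewrite gt_eqF.
apply: (mulfI h0); have [_ <-] := has_integral_average e hr.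
suff [_ ->] : has_integral `[t, t + h] (fun u => y u e 0)
  (h * average_outflow t h e) by [].
apply: (has_integral_ae (mitv _ _) _ (has_integral_outflow e hr)).
apply: filterS compl => u + uth; have Tu := rsub hr uth.
move=> /(_ Tu)[_ ow _ _]; have wu : 0 < w u e 0 by apply: wpos; move: uth; rewrite /= in_itv.
by have := perp_eq0l ow wu; rewrite mxE [X in _ + X]mxE; lra.
Qed.

Lemma average_flow_slack h e : 0 < h <= r ->
  (forall u, t <= u <= t + h -> 0 < slack G w p u e) ->
  average_flow t h e = 0.
Proof.
move=> hr spos; have h0 : h != 0 by case/andP: hr => h0 _; rewrite gt_eqF.
apply: (mulfI h0); have [_ <-] := has_integral_average e hr; rewrite mulr0.
suff [_ ->] : has_integral `[t, t + h] (fun u => y u e 0) 0 by [].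
apply: (has_integral_ae (mitv _ _) _ (has_integral0 (mitv _ _))).
apply: filterS compl => u + uth; have Tu := rsub hr uth.
move=> /(_ Tu)[_ _ wy _]; have wu : 0 < slack G w p u e by apply: spos; move: uth; rewrite /= in_itv.
by have /eqP := perp_eq0 wy e; rewrite mulf_eq0 gt_eqF// => /eqP.
Qed.

Lemma average_origin_eq0 h i : 0 < h <= r ->
  (forall u, t <= u <= t + h -> 0 < (p u + sched N s u - rho) i 0) ->
  \sum_e A i e * average_flow t h e = 0.
Proof.
move=> hr spos; have h0 : h != 0 by case/andP: hr => h0 _; rewrite gt_eqF.
apply: (mulfI h0); have [_ <-] := has_integral_origin i hr; rewrite mulr0.
suff [_ ->] : has_integral `[t, t + h] (fun u => q u i 0) 0 by [].
apply: (has_integral_ae (mitv _ _) _ (has_integral0 (mitv _ _))).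
apply: filterS compl => u + uth; have Tu := rsub hr uth.
move=> /(_ Tu)[_ _ _ pq].
have wu : 0 < (p u + sched N s u - rho) i 0 by apply: spos; move: uth; rewrite /= in_itv.
by have /eqP := perp_eq0 pq i; rewrite mulf_eq0 gt_eqF// => /eqP.
Qed.

End At.

(** The conditions of the equilibrium that involve flows at the single time [t],
    with the origin flow eliminated by conservation. *)
Definition admissible_flow t (x : 'cV[R]_L) : Prop :=
  [/\ nonneg x, nonneg (A *m x),
      perp (w t - A^T *m p t + c) x,
      perp (p t + sched N s t - rho) (A *m x) &
      TT° t -> derivable w t 1 -> derivable p t 1 ->
        perp (out t - x) (w t)].

Lemma cvg_average_outflow t e : derivable w t 1 -> derivable p t 1 ->
  average_outflow t h e @[h --> 0^'+] --> out t e 0.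
Proof.
move=> dw dp; rewrite queue_outflowE.
have [dwe ->] := derive1_coord e dw.
have [dpe ->] := derivable_node_value (link G e).1 dp.
apply: cvgM; first exact: cvg_cst.
apply: cvgD; last exact: cvg_cst.
by apply: cvgB; apply: cvg_dnbhs_at_right; exact: cvg_quotient.
Qed.

(** Complementarity almost everywhere yields an admissible flow at each single
    time. If [w] and [p] are differentiable at [t], take a limit point of the
    averages of [y] over [[t, t + h]] as [h] tends to 0. The averages lie
    between 0 and the mean outflow, which converges to the outflow at [t] because
    it consists of difference quotients; and a complementary factor that is
    positive at [t] stays positive just after [t], which fixes the averages
    there. If a derivative is missing, the zero flow is admissible. *)
Lemma exists_admissible_flow t : t \in T -> exists x, admissible_flow t x.
Proof.
move=> Tt; have [w0 wp0 pr0] := dual Tt.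
have [[T't dw dp]|nd] := pselect [/\ TT° t, derivable w t 1 & derivable p t 1];
  last first.
  exists 0; rewrite /admissible_flow mulmx0.
  have n0 n : nonneg (0 : 'cV[R]_n) by move=> i; rewrite mxE.
  have d0 n (a : 'cV[R]_n) : dot a 0 = 0 by rewrite /dot mulmx0 mxE.
  by split=> // *; exfalso; apply: nd.
have [r r0 rT0] := interior_itvP T't.
have rT (h : R) : 0 < h <= r -> TT (t + h).
  by move=> /andP[h0 hr]; apply: rT0; rewrite addrAC subrr add0r gtr0_norm.
have near_r (d : R) : 0 < d -> \forall h \near 0^'+, 0 < h <= d.
  move=> d0; near=> h; apply/andP; split; first by near: h; exact: nbhs_right_gt.
  by near: h; exact: nbhs_right_le.
have [U [UU FU]] := ultraFilterLemma (@at_right_proper_filter R 0).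
have PU : ProperFilter U by exact: ultra_proper.
have PF : Filter U by exact: filter_filter.
have toU P : (\forall h \near 0^'+, P h) -> \forall h \near U, P h by exact: FU.
have cvgU (f : R -> R) (l : R) : f h @[h --> 0^'+] --> l -> f @ U --> l.
  by move=> fl V /fl; exact: FU.
have outU e : average_outflow t ^~ e @ U --> out t e 0.
  by apply: cvgU; exact: cvg_average_outflow.
have /choice[l lU] : forall e, exists l : R, average_flow t ^~ e @ U --> l.
  move=> e; apply: (ultra_cvg_bounded (a := 0) (b := out t e 0 + 1) UU).
  have o1 : out t e 0 < out t e 0 + 1 by rewrite ltrDl.
  have near_o : \forall h \near U, average_outflow t h e < out t e 0 + 1.
    exact: (cvgr_lt _ (outU e)).
  apply: filterS2 near_o (toU _ (near_r _ r0)) => h ho hr.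
  rewrite (average_flow_ge0 Tt rT)//=; apply: le_trans (ltW ho).
  exact: (average_flow_le Tt rT).
have l0 e : 0 <= l e.
  apply: (cvgr_to_ge (lU e)); apply: filterS (toU _ (near_r _ r0)) => h hr.
  exact: (average_flow_ge0 Tt rT).
have lout e : l e <= out t e 0.
  apply: (ler_cvg_to (lU e) (outU e)).
  by apply: filterS (toU _ (near_r _ r0)) => h hr; exact: (average_flow_le Tt rT).
pose x : 'cV[R]_L := \col_e l e.
have AxU i : (fun h => \sum_e A i e * average_flow t h e) @ U --> (A *m x) i 0.
  rewrite mxE; under eq_bigr do rewrite [x _ _]mxE.
  apply: cvg_big => [|e _]; first by exact: add_continuous.
  by apply: cvgM; [exact: cvg_cst|exact: lU].
have sub (d h : R) : 0 < h <= d -> forall u, t <= u <= t + h -> t <= u <= t + d.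
  by move=> /andP[_ hd] u /andP[-> /= uh]; apply: le_trans uh _; rewrite lerD2l.
have small (d : R) : 0 < d -> \forall h \near U, 0 < h <= r /\ 0 < h <= d.
  move=> d0; apply: filterS2 (toU _ (near_r _ r0)) (toU _ (near_r _ d0)) => h.
  by split.
have x0 : nonneg x by move=> e; rewrite mxE.
have Ax0 : nonneg (A *m x).
  move=> i; apply: (cvgr_to_ge (AxU i)).
  by apply: filterS (toU _ (near_r _ r0)) => h hr; exact: (average_origin_ge0 Tt rT).
exists x; split=> //.
- split=> //; apply/dot_eq0 => // e; rewrite [x _ _]mxE -/(slack G w p t e).
  have [->|st] := eqVneq (slack G w p t e) 0; first by rewrite mul0r.
  have {}st : 0 < slack G w p t e by rewrite lt_neqAle eq_sym st; exact: wp0.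
  suff -> : l e = 0 by rewrite mulr0.
  have ds : derivable (slack G w p ^~ e) t 1.
    have [dwe _] := derive1_coord e dw.
    have [dp1 _] := derivable_node_value (link G e).1 dp.
    have [dp2 _] := derivable_node_value (link G e).2 dp.
    have -> : slack G w p ^~ e = (fun u => w u e 0 + c e 0 -
       node_value (p u) (link G e).1 + node_value (p u) (link G e).2).
      by apply/funext => u; rewrite slackE.
    exact: derivableD (derivableB (derivableD dwe (derivable_cst _ _ _)) dp1) dp2.
  have [d d0 dP] := derivable_gt0_near ds st.
  apply: (cvg_unique _ (lU e)) => //; apply: cvg_near_cst.
  apply: filterS (small d d0) => h [hr hd].
  by apply: (average_flow_slack Tt rT hr) => u /(sub _ _ hd); exact: dP.
- split=> //; apply/dot_eq0 => // i.
  have [->|st] := eqVneq ((p t + sched N s t - rho) i 0) 0; first by rewrite mul0r.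
  have {}st : 0 < (p t + sched N s t - rho) i 0 by rewrite lt_neqAle eq_sym st; exact: pr0.
  suff -> : (A *m x) i 0 = 0 by rewrite mulr0.
  (* [s] may have a kink at [t]; to the right of [t] it lies above the line of
     slope -1 through its value at [t], which takes its place. *)
  pose f u := p u i 0 + (t + s t - rho i 0) - u.
  have df : derivable f t 1.
    have [dpi _] := derive1_coord i dp.
    have did : derivable (fun u : R => u) t 1 by exact: derivable_id.
    have dc : derivable (fun _ : R => t + s t - rho i 0) t 1 by exact: derivable_cst.
    exact: (derivableB (derivableD dpi dc) did).
  have ft : 0 < f t by move: st; rewrite !mxE /f; lra.
  have [d d0 dP] := derivable_gt0_near df ft.
  apply: (cvg_unique _ (AxU i)) => //; apply: cvg_near_cst.
  apply: filterS (small d d0) => h [hr hd].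
  apply: (average_origin_eq0 Tt rT hr) => u /[dup] uh /(sub _ _ hd) /dP.
  rewrite !mxE /f => fu.
  case/andP: uh; rewrite le_eqVlt => /predU1P[<-|tu] uh; first by move: st; rewrite !mxE.
  have Tu : TT u by apply: (itv_between Tt (rT h hr)); rewrite ltW.
  have := schedule_slope hs T't Tu tu; lra.
- move=> _ _ _; have ox0 : nonneg (out t - x).
    move=> e; rewrite mxE [X in _ + X]mxE [x _ _]mxE subr_ge0; exact: lout.
  split=> //; apply/dot_eq0 => // e.
  have [->|st] := eqVneq (w t e 0) 0; first by rewrite mulr0.
  have {}st : 0 < w t e 0 by rewrite lt_neqAle eq_sym st; exact: w0.
  suff lE : l e = out t e 0 by rewrite mxE [X in _ + X]mxE [x _ _]mxE lE subrr mul0r.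
  have [dwe _] := derive1_coord e dw.
  have [d d0 dP] := derivable_gt0_near dwe st.
  apply: (cvg_unique _ (lU e)) => //.
  apply: cvg_trans (outU e); apply: near_eq_cvg.
  apply: filterS (small d d0) => h [hr hd].
  by apply/esym/(average_flow_queue Tt rT hr) => u /(sub _ _ hd); exact: dP.
Unshelve. all: by end_near.
Qed.

End Averaging.

(** * From a zero gap to equilibrium *)

Section Sufficiency.
Variables (R : realType) (N L : nat) (G : network R N L).
Variables (T : interval R) (s : R -> R) (tP : R).
Local Notation A := (incidence G).
Local Notation c := (free_time G).
Local Notation TT := [set` T].

(** A zero gap makes the flow complementary to [wC], [piC] and [rhoC] almost
    everywhere; on the exceptional null set it is replaced by an admissible
    flow, which no integral notices. *)
Lemma flow_lp_zero_gqrp qC yC wC piC rhoC q y :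
  schedule_cost T s tP -> cost_solution G T s qC yC wC piC rhoC ->
  flow_lp_feasible G T s wC piC q y -> ZF G T s wC piC rhoC q y = 0 ->
  gqrp G T s wC.
Proof.
move=> hs [costC ettC regfC regdC] feas ZF0.
have [varsC qCQ lcpC] := costC.
have [regf qy0 qQ Aq cap] := feas.
have mT : measurable TT by exact: measurable_itv.
have dual t : t \in T -> [/\ nonneg (wC t), nonneg (wC t - A^T *m piC t + c) &
     nonneg (piC t + sched N s t - rhoC)].
  move=> tT; have [/(_ t tT)[_ _ w0 _] _] := varsC.
  by have [_ _ [] ? _ _ []] := lcpC t tT.
have gap_ge0 := gap_density_ge0 dual regdC feas.
have gap_eq0 := has_integral_gap rhoC regf regdC qQ.
rewrite ZF0 in gap_eq0.
have {}gap_eq0 : {ae @lebesgue_measure R, forall t, TT t ->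
  gap_density G (s t) (q t) (y t) (wC t) (derive1 wC t) (derive1 piC t) rhoC = 0}.
  apply: (has_integral_eq0 mT _ gap_eq0).
  by apply: filterS gap_ge0 => t + Tt => /(_ Tt)[].
have compl : {ae @lebesgue_measure R, forall t, TT t ->
  [/\ nonneg (queue_outflow G (derive1 wC t) (derive1 piC t) - y t),
      perp (queue_outflow G (derive1 wC t) (derive1 piC t) - y t) (wC t),
      perp (wC t - A^T *m piC t + c) (y t) &
      perp (piC t + sched N s t - rhoC) (q t)]}.
  apply: filterS2 gap_ge0 gap_eq0 => t + + Tt => /(_ Tt)[out0 _] /(_ Tt).
  rewrite (gap_densityE _ _ _ (piC t) _ _ (Aq t Tt)).
  have [w0 wp0 pr0] := dual t Tt; have [q0 y0] := qy0 t Tt.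
  have d1 := dot_ge0 wp0 y0; have d2 := dot_ge0 w0 out0.
  have d3 := dot_ge0 pr0 q0; rewrite -/(sched N s t) => d0.
  split=> //; split=> //; first (rewrite dotC); lra.
have [qi sqi yi] := regf.
have y0 t : t \in T -> nonneg (y t) by move=> /qy0[].
have q0 t : t \in T -> nonneg (q t) by move=> /qy0[].
have adm_ex := exists_admissible_flow hs regdC yi y0 q0 Aq dual compl.
pose adm := admissible_flow G T s wC piC rhoC.
(* [y], repaired where complementarity fails. *)
pose y1 t := if pselect (adm t (y t)) then y t else xget 0 [set x | adm t x].
have y1P t : t \in T -> adm t (y1 t).
  move=> tT; rewrite /y1 /=; case: (pselect (adm t (y t))) => //= nadm.
  by have [x xP] := adm_ex t tT; apply: (@xgetPex _ 0 [set x | adm t x]); exists x.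
have y1E : {ae @lebesgue_measure R, forall t, TT t -> y1 t = y t}.
  apply: filterS compl => t + Tt => /(_ Tt)[_ ow wy pq].
  rewrite /y1 /=; case: (pselect (adm t (y t))) => //= nadm; exfalso; apply: nadm.
  have qE : A *m y t = q t by move/eqP: (Aq t Tt); rewrite subr_eq0 => /eqP.
  by split; rewrite ?qE; [exact: y0|exact: q0|..].
have q1E : {ae @lebesgue_measure R, forall t, TT t -> A *m y1 t = q t}.
  apply: filterS y1E => t + Tt => /(_ Tt) ->.
  by move/eqP: (Aq t Tt); rewrite subr_eq0 => /eqP.
exists (fun t => A *m y1 t), y1, wC, piC, rhoC; split=> //; split=> //.
- split.
  + split; last by case: varsC.
    move=> t tT; have [y10 q10 _ _ _] := y1P t tT.
    by have [/(_ t tT)[_ _ w0 p0] _] := varsC.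
  + rewrite -qQ; apply/colP => i; rewrite !mxE.
    apply: (has_integral_ae mT _ (conj (qi i) erefl)).2.
    by apply: filterS q1E => t + Tt => /(_ Tt) ->.
  + move=> t T't dw dp; rewrite -queue_outflow_capacity.
    by have [_ _ _ _] := y1P t (interior_subset T't); apply.
  + move=> t T't dp i; have [dpi ->] := derive1_coord i dp.
    have [_ acp _ _ _] := regdC.
    apply: (derive1_le_ae (acp i) _ T't dpi).
    apply: filterS (ae_regular_derivable regdC) => u + Tu => /(_ Tu)[T'u dwu dpu].
    have [_ <-] := derive1_coord i dpu.
    apply: (derive_travel_time_le1_at hs costC ettC i T'u dwu dpu) => e.
    have := cap u T'u dwu dpu e; rewrite mxE [X in _ + X]mxE subr_ge0.
    by apply: le_trans; exact: y0.
  + move=> t tT; have [y10 q10 wy pq _] := y1P t tT.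
    by rewrite subrr.
- split.
  + move=> i; apply: (lebesgue_integrable_ae mT _ (qi i)).
    by apply: filterS q1E => t + Tt => /(_ Tt) ->.
  + move=> i; apply: (lebesgue_integrable_ae mT _ (sqi i)).
    by apply: filterS q1E => t + Tt => /(_ Tt) ->.
  + move=> e; apply: (lebesgue_integrable_ae mT _ (yi e)).
    by apply: filterS y1E => t + Tt => /(_ Tt) ->.
Qed.

End Sufficiency.

Theorem theorem3p1 (R : realType) (N L : nat) (G : network R N L)
    (T : interval R) (s : R -> R) (tP : R)
    (hs : schedule_cost T s tP)
    (qC : R -> 'cV[R]_N) (yC wC : R -> 'cV[R]_L)
    (piC : R -> 'cV[R]_N) (rhoC : 'cV[R]_N)
    (hC : cost_solution G T s qC yC wC piC rhoC) :
  gqrp G T s wC <->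
  exists qF yF, flow_lp_solution G T s wC piC rhoC qF yF /\
                ZF G T s wC piC rhoC qF yF = 0.
Proof.
split=> [|[qF [yF [[feas _] ZF0]]]]; first exact: gqrp_flow_lp_solution hC.
exact: flow_lp_zero_gqrp hs hC feas ZF0.
Qed.
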